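(* Let $H$ be a finite dimensional Hopf algebra over a field $k$, and let $A$ be a finite dimensional right $H$-comodule algebra which is a Frobenius algebra in the category $\mathcal{M}^H$. Then the smash product $A\# H^*$ is a Frobenius algebra in the category $\mathcal{M}^{H^*}$.
   Context: $\mathcal{M}^H$ is the monoidal category of right $H$-comodules over a Hopf algebra $H$ with antipode $S$; an algebra in $\mathcal{M}^H$ is a right $H$-comodule algebra, with coaction written $a\mapsto\sum a_0\otimes a_1$. Any right $H$-comodule is a left $H^*$-module by $h^*\cdot a=\sum h^*(a_1)a_0$. An algebra $A$ in a monoidal category is a Frobenius algebra in that category if it also has a coalgebra structure in the category whose comultiplication is a morphism of $A,A$-bimodules. For a finite dimensional right $H$-comodule algebra $A$ it is known that this is equivalent to $A\simeq A^*$ in $\mathcal{M}^H_A$ (the category of right $A$-modules in $\mathcal{M}^H$), where $A^*$ has the usual right $A$-action $(a^*a)(b)=a^*(ab)$ and the coaction determined by $\sum a^*_0(a)a^*_1=\sum a^*(a_0)S(a_1)$. It is also equivalent to the existence of a linear map $\lambda:A\to k$ with $\lambda(h^*\cdot a)=h^*(1)\lambda(a)$ for all $a\in A,h^*\in H^*$ such that $\mathrm{Ker}\,\lambda$ contains no non-zero right ideal of $A$ (equivalently, no non-zero right ideal of $A$ that is also an $H$-subcomodule). For $H$ finite dimensional, $A$ is a left $H^*$-module algebra and the smash product $A\# H^*$ is the vector space $A\otimes H^*$ with multiplication $(a\# h^* )(b\# g^* )=\sum a(h^*_1\cdot b)\# h^*_2g^*$. It is a right $H^*$-comodule algebra with coaction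 $a\# h^*\mapsto\sum (a\# h^*_1)\otimes h^*_2$. *)

(* Defs.v *)
From HB Require Import structures.
From mathcomp Require Import all_boot all_order all_algebra.

Set Implicit Arguments.
Unset Strict Implicit.
Unset Printing Implicit Defensive.

Import GRing.Theory.
Local Open Scope ring_scope.

Reserved Notation "u ⊗ v" (at level 40, left associativity).
Reserved Notation "x ⋅ y" (at level 39, left associativity).
Reserved Notation "f ⇀ a" (at level 39, no associativity).
Reserved Notation "\tsum_ ( u ⊗ v <- t ) F"
  (at level 41, u name, v name, t at level 200, F at level 41,
   format "'[' \tsum_ ( u  ⊗  v  <-  t ) '/  '  F ']'").

(* The tensor product of two finite dimensional spaces, in the coordinates    *)
(* given by their standard bases: u ⊗ v is the matrix of the products of the  *)
(* coordinates of u and v. If F is bilinear, then \tsum_(u ⊗ v <- t) F u v    *)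
(* is the value at t of the linear map sending each u ⊗ v to F u v (lemma     *)
(* tsum_tens); it plays the role of Sweedler's notation.                      *)
Definition tensor (k : fieldType) (U V : vectType k) :=
  'M[k]_(\dim {:U}, \dim {:V}).

HB.instance Definition _ (k : fieldType) (U V : vectType k) :=
  Vector.on (tensor U V).

Definition tens (k : fieldType) (U V : vectType k) (u : U) (v : V) :
    tensor U V :=
  \matrix_(i, j) (coord (vbasis {:U}) i u * coord (vbasis {:V}) j v).

Definition tsum (k : fieldType) (U V : vectType k) (W : lmodType k)
    (t : tensor U V) (F : U -> V -> W) : W :=
  \sum_i \sum_j t i j *: F (vbasis {:U})`_i (vbasis {:V})`_j.

Arguments tens {k U V} u v.
Arguments tsum {k U V W} t F.

Notation "u ⊗ v" := (tens u v) : ring_scope.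
Notation "\tsum_ ( u ⊗ v <- t ) F" := (tsum t (fun u v => F)) : ring_scope.

Section TensorTheory.
Variable k : fieldType.
Implicit Types U V W X Y : vectType k.

(* A rigid copy of linear, so that the closure lemmas below can be used by    *)
(* apply.                                                                     *)
Definition islin (U V : lmodType k) (f : U -> V) : Prop := linear f.

Lemma tens_linl U V (v : V) : islin (fun u : U => u ⊗ v).
Proof.
by move=> a u1 u2; apply/matrixP=> i j; rewrite !mxE linearP mulrDl mulrA.
Qed.

Lemma tens_linr U V (u : U) : islin (fun v : V => u ⊗ v).
Proof.
move=> a v1 v2; apply/matrixP=> i j; rewrite !mxE linearP mulrDr.
by rewrite mulrCA.
Qed.

Lemma tsum_islin U V (W : lmodType k) (F : U -> V -> W) : islin (tsum ^~ F).
Proof.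
move=> a s t; rewrite /tsum scaler_sumr -big_split /=; apply: eq_bigr => i _.
rewrite scaler_sumr -big_split /=; apply: eq_bigr => j _.
by rewrite !mxE scalerDl scalerA.
Qed.

Lemma islin_comp (U V W : lmodType k) (g : V -> W) (f : U -> V) :
  islin g -> islin f -> islin (fun x => g (f x)).
Proof. by move=> lg lf a u v; rewrite lf lg. Qed.

Lemma islin_id (U : lmodType k) : islin (fun x : U => x).
Proof. by []. Qed.

Lemma islin_linear (U V : lmodType k) (f : {linear U -> V}) : islin f.
Proof. exact: linearP. Qed.

Lemma islin_tensl (U : lmodType k) V W (f : U -> V) (w : W) :
  islin f -> islin (fun x => f x ⊗ w).
Proof. by move=> lf a u v; rewrite lf tens_linl. Qed.

Lemma islin_tensr (U : lmodType k) V W (f : U -> W) (v : V) :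
  islin f -> islin (fun x => v ⊗ f x).
Proof. by move=> lf a u w; rewrite lf tens_linr. Qed.

Lemma islin_tsum (X : lmodType k) U V (W : lmodType k) (F : U -> V -> W)
  (f : X -> tensor U V) : islin f -> islin (fun x => tsum (f x) F).
Proof. by move=> lf a u v; rewrite lf tsum_islin. Qed.

Lemma islin_tsumF (X : lmodType k) U V (W : lmodType k) (F : X -> U -> V -> W)
  (t : tensor U V) :
  (forall u v, islin (fun x => F x u v)) ->
  islin (fun x => tsum t (F x)).
Proof.
move=> lF a x y; rewrite /tsum scaler_sumr -big_split /=; apply: eq_bigr => i _.
rewrite scaler_sumr -big_split /=; apply: eq_bigr => j _.
by rewrite lF scalerDr !scalerA mulrC.
Qed.

Lemma islin_scaler (U V : lmodType k) (c : k) (f : U -> V) :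
  islin f -> islin (fun x => c *: f x).
Proof. by move=> lf a u v; rewrite lf scalerDr !scalerA mulrC. Qed.

Lemma islin_scalel (U V : lmodType k) (f : U -> k^o) (w : V) :
  islin f -> islin (fun x => (f x : k) *: w).
Proof. by move=> lf a u v; rewrite lf scalerDl scalerA. Qed.

Lemma islin_kmull (U : lmodType k) (f : U -> k^o) (c : k) :
  islin f -> islin (fun x => f x * c : k^o).
Proof. by move=> lf a u v; rewrite lf mulrDl -mulrA. Qed.

Lemma islin_kmulr (U : lmodType k) (f : U -> k^o) (c : k) :
  islin f -> islin (fun x => c * f x : k^o).
Proof. by move=> lf a u v; rewrite lf mulrDr mulrCA. Qed.

Lemma islin_lfun (U : lmodType k) V W (f : U -> 'Hom(V, W)) (v : V) :
  islin f -> islin (fun x => f x v).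
Proof. by move=> lf a u w; rewrite lf add_lfunE scale_lfunE. Qed.

Lemma eq_tsum U V (W : lmodType k) (F G : U -> V -> W) t :
  (forall u v, F u v = G u v) -> tsum t F = tsum t G.
Proof.
by move=> eFG; apply: eq_bigr => i _; apply: eq_bigr => j _; rewrite eFG.
Qed.

Lemma tsum_tens U V (W : lmodType k) (F : U -> V -> W) u v :
    (forall v', islin (F^~ v')) -> (forall u', islin (F u')) ->
  tsum (u ⊗ v) F = F u v.
Proof.
move=> linl linr.
pose Fl v := GRing.isLinear.Build k U W *:%R (F^~ v) (linl v).
pose gl v : {linear U -> W} := HB.pack (F^~ v) (Fl v).
pose Fr u := GRing.isLinear.Build k V W *:%R (F u) (linr u).
pose gr u : {linear V -> W} := HB.pack (F u) (Fr u).
rewrite [in RHS](coord_vbasis (memvf u)) -[RHS]/(gl v _) linear_sum.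
apply: eq_bigr => i _; rewrite linearZ /=.
rewrite -[X in _ = _ *: X]/(gr _ v) [in RHS](coord_vbasis (memvf v)) linear_sum.
rewrite scaler_sumr; apply: eq_bigr => j _.
by rewrite linearZ /= mxE scalerA.
Qed.

Lemma tsum_comp U V (W X : lmodType k) (g : W -> X) (F : U -> V -> W) t :
  islin g -> g (tsum t F) = tsum t (fun u v => g (F u v)).
Proof.
move=> lg; pose gm := GRing.isLinear.Build k W X *:%R g lg.
pose gl : {linear W -> X} := HB.pack g gm.
rewrite -[g]/(gl : _ -> _) /tsum linear_sum; apply: eq_bigr => i _.
by rewrite linear_sum; apply: eq_bigr => j _; rewrite linearZ.
Qed.

Lemma tsumE U V (W : lmodType k) (F : U -> V -> W) t :
  tsum t F = \sum_p t p.1 p.2 *: F (vbasis {:U})`_p.1 (vbasis {:V})`_p.2.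
Proof. by rewrite /tsum pair_bigA. Qed.

Lemma tsum_swap U V X Y (W : lmodType k) (F : U -> V -> X -> Y -> W) s t :
  \tsum_(u ⊗ v <- s) \tsum_(x ⊗ y <- t) F u v x y =
  \tsum_(x ⊗ y <- t) \tsum_(u ⊗ v <- s) F u v x y.
Proof.
rewrite [LHS]tsumE [RHS]tsumE.
under eq_bigr => p _ do rewrite tsumE scaler_sumr.
rewrite exchange_big /=; apply: eq_bigr => q _.
rewrite tsumE scaler_sumr; apply: eq_bigr => p _.
by rewrite !scalerA mulrC.
Qed.

Lemma tsum_tensK U V (t : tensor U V) :
  \tsum_(u ⊗ v <- t) (u ⊗ v) = t.
Proof.
apply/matrixP=> i j; rewrite summxE (bigD1 i) //= summxE (bigD1 j) //=.
have cb W (a b : 'I_(\dim {:W})) :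
    coord (vbasis {:W}) a (vbasis {:W})`_b = (a == b)%:R.
  by rewrite coord_free ?(basis_free (vbasisP _)) // eq_sym.
rewrite !mxE !cb !eqxx !mulr1 big1 => [|j' /negPf nj]; last first.
  by rewrite !mxE !cb [j == j']eq_sym nj mulr0 mulr0.
rewrite big1 ?addr0 // => i' /negPf ni; rewrite summxE big1 // => j' _.
by rewrite !mxE !cb [i == i']eq_sym ni mul0r mulr0.
Qed.

End TensorTheory.

(* Finite dimensional associative unital algebras. Unlike falgType, this does *)
(* not exclude the zero algebra.                                              *)
HB.mixin Record isFdAlgebra (k : fieldType) A of Vector k A := {
  alg_mul : A -> A -> A;
  alg_one : A;
  alg_mul_linl : forall y, linear (fun x => alg_mul x y);
  alg_mul_linr : forall x, linear (alg_mul x);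
  alg_mulA : associative alg_mul;
  alg_mul1l : left_id alg_one alg_mul;
  alg_mul1r : right_id alg_one alg_mul
}.

#[short(type="fdAlgType")]
HB.structure Definition FdAlgebra (k : fieldType) :=
  {A of Vector k A & isFdAlgebra k A}.

Notation "x ⋅ y" := (alg_mul x y) : ring_scope.

Section CoalgebraAxioms.
Variables (k : fieldType) (C : vectType k).
Implicit Types (δ : C -> tensor C C) (ε : C -> k^o).

Definition coassociative δ := forall x,
  \tsum_(a ⊗ b <- δ x) \tsum_(a1 ⊗ a2 <- δ a) (a1 ⊗ (a2 ⊗ b)) =
  \tsum_(a ⊗ b <- δ x) (a ⊗ δ b).

Definition left_counit δ ε := forall x, \tsum_(a ⊗ b <- δ x) (ε a *: b) = x.

Definition right_counit δ ε := forall x, \tsum_(a ⊗ b <- δ x) (ε b *: a) = x.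

End CoalgebraAxioms.

HB.mixin Record isCoalgebra (k : fieldType) C of Vector k C := {
  comul : {linear C -> tensor C C};
  counit : {linear C -> k^o};
  comulA : coassociative comul;
  counitl : left_counit comul counit;
  counitr : right_counit comul counit
}.

#[short(type="coalgType")]
HB.structure Definition Coalgebra (k : fieldType) :=
  {C of Vector k C & isCoalgebra k C}.

HB.mixin Record isBialgebra (k : fieldType) H
    of FdAlgebra k H & Coalgebra k H := {
  comulM : forall x y : H, comul (x ⋅ y) =
    \tsum_(x1 ⊗ x2 <- comul x) \tsum_(y1 ⊗ y2 <- comul y)
      ((x1 ⋅ y1) ⊗ (x2 ⋅ y2));
  comul1 : comul (alg_one : H) = alg_one ⊗ alg_one;
  counitM : forall x y : H, counit (x ⋅ y) = counit x * counit y;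
  counit1 : counit (alg_one : H) = 1
}.

#[short(type="bialgType")]
HB.structure Definition Bialgebra (k : fieldType) :=
  {H of FdAlgebra k H & Coalgebra k H & isBialgebra k H}.

HB.mixin Record hasAntipode (k : fieldType) H of Bialgebra k H := {
  antipode : {linear H -> H};
  antipodel : forall x : H,
    \tsum_(x1 ⊗ x2 <- comul x) (antipode x1 ⋅ x2) = counit x *: (alg_one : H);
  antipoder : forall x : H,
    \tsum_(x1 ⊗ x2 <- comul x) (x1 ⋅ antipode x2) = counit x *: (alg_one : H)
}.

#[short(type="hopfAlgType")]
HB.structure Definition HopfAlgebra (k : fieldType) :=
  {H of Bialgebra k H & hasAntipode k H}.

Section ComoduleAxioms.
Variables (k : fieldType) (H : coalgType k) (V : vectType k).
Implicit Type ρ : V -> tensor V H.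

Definition coaction_assoc ρ := forall v,
  \tsum_(v0 ⊗ v1 <- ρ v) \tsum_(w0 ⊗ w1 <- ρ v0) (w0 ⊗ (w1 ⊗ v1)) =
  \tsum_(v0 ⊗ v1 <- ρ v) (v0 ⊗ comul v1).

Definition coaction_counit ρ := forall v,
  \tsum_(v0 ⊗ v1 <- ρ v) (counit v1 *: v0) = v.

End ComoduleAxioms.

HB.mixin Record isComodule (k : fieldType) (H : coalgType k) V
    of Vector k V := {
  coact : {linear V -> tensor V H};
  coactA : coaction_assoc coact;
  coact_counit : coaction_counit coact
}.

#[short(type="comodType")]
HB.structure Definition Comodule (k : fieldType) (H : coalgType k) :=
  {V of Vector k V & isComodule k H V}.

HB.mixin Record isComodAlgebra (k : fieldType) (H : bialgType k) A
    of FdAlgebra k A & Comodule k H A := {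
  coactM : forall a b : A, coact (a ⋅ b) =
    \tsum_(a0 ⊗ a1 <- coact a) \tsum_(b0 ⊗ b1 <- coact b)
      ((a0 ⋅ b0) ⊗ (a1 ⋅ b1));
  coact1 : coact (alg_one : A) = alg_one ⊗ alg_one
}.

#[short(type="comodAlgType")]
HB.structure Definition ComodAlgebra (k : fieldType) (H : bialgType k) :=
  {A of FdAlgebra k A & Comodule k H A & isComodAlgebra k H A}.

Section Sweedler.
Variable k : fieldType.

Lemma islin_mull (U : lmodType k) (A : fdAlgType k) (f : U -> A) (y : A) :
  islin f -> islin (fun x => f x ⋅ y).
Proof. by move=> lf a u v; rewrite lf alg_mul_linl. Qed.

Lemma islin_mulr (U : lmodType k) (A : fdAlgType k) (f : U -> A) (y : A) :
  islin f -> islin (fun x => y ⋅ f x).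
Proof. by move=> lf a u v; rewrite lf alg_mul_linr. Qed.

Lemma islin_map (U V W : lmodType k) (g : {linear V -> W}) (f : U -> V) :
  islin f -> islin (fun x => g (f x)).
Proof. by move=> lf a u v; rewrite lf linearP. Qed.

Lemma islin_lfunv (U : lmodType k) (V W : vectType k) (f : 'Hom(V, W))
    (g : U -> V) :
  islin g -> islin (fun x => f (g x)).
Proof. by move=> lg a u v; rewrite lg linearP. Qed.

Lemma tsum_tsum (U V X Y : vectType k) (W : lmodType k) (t : tensor X Y)
    (G : X -> Y -> tensor U V) (F : U -> V -> W) :
  tsum (tsum t G) F = \tsum_(x ⊗ y <- t) tsum (G x y) F.
Proof. exact: (tsum_comp _ _ (tsum_islin F)). Qed.

Lemma map_tsum (U V : vectType k) (W X : lmodType k) (g : {linear W -> X})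
    (t : tensor U V) (F : U -> V -> W) :
  g (tsum t F) = \tsum_(u ⊗ v <- t) g (F u v).
Proof. exact: (tsum_comp _ _ (islin_linear g)). Qed.

Lemma tensl_tsum (U V X Y : vectType k) (t : tensor U V) (F : U -> V -> X)
    (y : Y) :
  tsum t F ⊗ y = \tsum_(u ⊗ v <- t) (F u v ⊗ y).
Proof. exact: (tsum_comp _ _ (tens_linl y)). Qed.

Lemma tensr_tsum (U V X Y : vectType k) (t : tensor U V) (F : U -> V -> Y)
    (x : X) :
  x ⊗ tsum t F = \tsum_(u ⊗ v <- t) (x ⊗ F u v).
Proof. exact: (tsum_comp _ _ (@tens_linr _ _ _ x)). Qed.

Lemma mull_tsum (U V : vectType k) (A : fdAlgType k) (t : tensor U V)
    (F : U -> V -> A) (y : A) :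
  tsum t F ⋅ y = \tsum_(u ⊗ v <- t) (F u v ⋅ y).
Proof. exact: (tsum_comp _ _ (alg_mul_linl y)). Qed.

Lemma mulr_tsum (U V : vectType k) (A : fdAlgType k) (t : tensor U V)
    (F : U -> V -> A) (x : A) :
  x ⋅ tsum t F = \tsum_(u ⊗ v <- t) (x ⋅ F u v).
Proof. exact: (tsum_comp _ _ (alg_mul_linr x)). Qed.

Lemma scaler_tsum (U V : vectType k) (W : lmodType k) (t : tensor U V)
    (F : U -> V -> W) (c : k) :
  c *: tsum t F = \tsum_(u ⊗ v <- t) (c *: F u v).
Proof. exact: (tsum_comp _ _ (islin_scaler c (@islin_id _ W))). Qed.

Lemma scalel_tsum (U V : vectType k) (W : lmodType k) (t : tensor U V)
    (F : U -> V -> k^o) (w : W) :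
  (tsum t F : k) *: w = \tsum_(u ⊗ v <- t) ((F u v : k) *: w).
Proof. exact: (tsum_comp _ _ (islin_scalel w (@islin_id _ k^o))). Qed.

Lemma islinZ (U V : lmodType k) (f : U -> V) : islin f -> scalable f.
Proof.
move=> lf; pose F := GRing.isLinear.Build k U V *:%R f lf.
by pose g : {linear U -> V} := HB.pack f F; move=> a u; rewrite -[f]/(g : _ -> _) linearZ.
Qed.

Lemma scale_tensl (U V : vectType k) (c : k) (u : U) (v : V) :
  (c *: u) ⊗ v = c *: (u ⊗ v).
Proof. exact: (islinZ (tens_linl v)). Qed.

Lemma scale_tensr (U V : vectType k) (c : k) (u : U) (v : V) :
  u ⊗ (c *: v) = c *: (u ⊗ v).
Proof. exact: (islinZ (@tens_linr _ U V u)). Qed.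

Lemma scale_mull (A : fdAlgType k) (c : k) (x y : A) :
  (c *: x) ⋅ y = c *: (x ⋅ y).
Proof. exact: (islinZ (alg_mul_linl y)). Qed.

Lemma scale_mulr (A : fdAlgType k) (c : k) (x y : A) :
  x ⋅ (c *: y) = c *: (x ⋅ y).
Proof. exact: (islinZ (alg_mul_linr x)). Qed.

End Sweedler.

Ltac lin1 := first
  [ exact: islin_id | match goal with H : _ |- _ => exact: H end | exact: islin_linear
  | apply: islin_tsumF => ? ?; solve [lin1]
  | apply: islin_tsum; solve [lin1]
  | apply: islin_tensl; solve [lin1]
  | apply: islin_tensr; solve [lin1]
  | apply: islin_mull; solve [lin1]
  | apply: islin_mulr; solve [lin1]
  | apply: islin_kmull; solve [lin1]
  | apply: islin_kmulr; solve [lin1]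
  | apply: islin_scalel; solve [lin1]
  | apply: islin_scaler; solve [lin1]
  | apply: islin_map; solve [lin1]
  | apply: islin_lfun; solve [lin1]
  | apply: islin_lfunv; solve [lin1] ].
Ltac lin := intros; solve [lin1].

Ltac tens := rewrite tsum_tens; [ | by lin | by lin].

Section CoalgTheory.
Variables (k : fieldType) (C : coalgType k).

Lemma comulA_tsum (W : lmodType k) (F : C -> C -> C -> W) x :
  (forall b c, islin (fun a => F a b c)) ->
  (forall a c, islin (fun b => F a b c)) ->
  (forall a b, islin (fun c => F a b c)) ->
  \tsum_(a ⊗ b <- comul x) \tsum_(a1 ⊗ a2 <- comul a) F a1 a2 b =
  \tsum_(a ⊗ b <- comul x) \tsum_(b1 ⊗ b2 <- comul b) F a b1 b2.
Proof.
move=> l1 l2 l3.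
have := congr1 (fun t => \tsum_(a ⊗ bc <- t) \tsum_(b ⊗ c <- bc) F a b c)
  (comulA x).
rewrite /= !tsum_tsum => eq; etransitivity; [|etransitivity; [exact: eq|]].
  apply: eq_tsum => a b; rewrite tsum_tsum; apply: eq_tsum => a1 a2.
  by tens; tens.
by apply: eq_tsum => a b; tens.
Qed.

End CoalgTheory.

Definition dual (k : fieldType) (V : vectType k) := 'Hom(V, k^o).

HB.instance Definition _ (k : fieldType) (V : vectType k) :=
  Vector.on (dual V).

Section DualTheory.
Variable k : fieldType.
Implicit Types U V W : vectType k.

Lemma linfunE V W (f : V -> W) : islin f -> linfun f =1 f.
Proof.
move=> lf; pose F := GRing.isLinear.Build k V W *:%R f lf.
by pose g : {linear V -> W} := HB.pack f F; move=> x; rewrite -[f]/(g : _ -> _) lfunE.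
Qed.

Lemma islin_dual (U : lmodType k) V (f : U -> dual V) (v : V) :
  islin f -> islin (fun x => f x v : k^o).
Proof. exact: islin_lfun. Qed.

Lemma islin_dualv (U : lmodType k) V (f : dual V) (g : U -> V) :
  islin g -> islin (fun x => f (g x) : k^o).
Proof. by move=> lg a u v; rewrite lg linearP. Qed.

Lemma dual_tsum (U V X : vectType k) (f : dual X) (t : tensor U V)
    (F : U -> V -> X) :
  f (tsum t F) = \tsum_(u ⊗ v <- t) (f (F u v) : k^o).
Proof. exact: (tsum_comp _ _ (islin_dualv f (@islin_id _ X))). Qed.

Definition dual_vec V (i : 'I_(\dim {:V})) : dual V :=
  linfun (coord (vbasis {:V}) i : V -> k^o).

Lemma dual_vecE V i v : dual_vec i v = coord (vbasis {:V}) i v.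
Proof. by rewrite linfunE // => a u w; rewrite linearP. Qed.

Lemma dual_sum V (f : dual V) :
  \sum_(i < \dim {:V}) f (vbasis {:V})`_i *: dual_vec i = f.
Proof.
apply/lfunP=> v; rewrite sum_lfunE [in RHS](coord_vbasis (memvf v)) linear_sum.
apply: eq_bigr => i _; rewrite scale_lfunE linearZ /= dual_vecE.
by rewrite /GRing.scale /= mulrC.
Qed.

Lemma sum_tsum (I : finType) U V (W : lmodType k) (F : I -> U -> V -> W)
    (t : tensor U V) :
  \sum_i tsum t (F i) = \tsum_(u ⊗ v <- t) \sum_i F i u v.
Proof.
rewrite tsumE; under eq_bigr => i _ do rewrite tsumE.
by rewrite exchange_big; apply: eq_bigr => p _; rewrite scaler_sumr.
Qed.

Lemma dual_tensK V W (t : tensor (dual V) W) :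
  \sum_(i < \dim {:V}) dual_vec i ⊗ (\tsum_(f ⊗ w <- t) (f (vbasis {:V})`_i : k) *: w) = t.
Proof.
under eq_bigr => i _ do rewrite tensr_tsum.
rewrite sum_tsum -[RHS]tsum_tensK; apply: eq_tsum => f w.
have l : islin (fun g : dual V => g ⊗ w) by lin.
pose F := GRing.isLinear.Build k _ _ *:%R _ l.
pose g : {linear dual V -> tensor (dual V) W} := HB.pack (fun g => g ⊗ w) F.
rewrite -[in RHS](dual_sum f) -[RHS]/(g _) linear_sum.
by apply: eq_bigr => i _; rewrite scale_tensr linearZ.
Qed.

Lemma dual_tens_ext V W (s t : tensor (dual V) W) :
  (forall v, \tsum_(f ⊗ w <- s) (f v : k) *: w =
             \tsum_(f ⊗ w <- t) (f v : k) *: w) -> s = t.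
Proof.
by move=> eq; rewrite -[s]dual_tensK -[t]dual_tensK; apply: eq_bigr => i _; rewrite eq.
Qed.

Lemma dual_tens2_ext V W (s t : tensor (dual V) (dual W)) :
  (forall v w, \tsum_(f ⊗ g <- s) (f v * g w : k^o) =
               \tsum_(f ⊗ g <- t) (f v * g w : k^o)) -> s = t.
Proof.
move=> eq; apply: dual_tens_ext => v; apply/lfunP => w.
have l : islin (fun g : dual W => g w) by apply: islin_lfun; apply: islin_id.
by rewrite !(tsum_comp _ _ l) /=; have := eq v w; congr (_ = _);
  apply: eq_tsum => f g; rewrite scale_lfunE.
Qed.

Lemma dual_tens3_ext U V W (s t : tensor (dual U) (tensor (dual V) (dual W))) :
  (forall u v w,
     \tsum_(f ⊗ p <- s) \tsum_(g ⊗ h <- p) (f u * (g v * h w) : k^o) =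
     \tsum_(f ⊗ p <- t) \tsum_(g ⊗ h <- p) (f u * (g v * h w) : k^o)) -> s = t.
Proof.
move=> eq; apply: dual_tens_ext => u; apply: dual_tens2_ext => v w.
rewrite !tsum_tsum; have := eq u v w; congr (_ = _); apply: eq_tsum => f p.
  by rewrite (islinZ (tsum_islin _)) scaler_tsum.
by rewrite (islinZ (tsum_islin _)) scaler_tsum.
Qed.

End DualTheory.

Section DualAlgebra.
Variables (k : fieldType) (C : coalgType k).
Implicit Types f g h : dual C.

(* convolution *)
Definition dual_mul f g : dual C :=
  linfun (fun x => \tsum_(x1 ⊗ x2 <- comul x) (f x1 * g x2 : k^o)).

Definition dual_one : dual C := linfun (counit : C -> k^o).

Lemma dual_mulE f g x :
  dual_mul f g x = \tsum_(x1 ⊗ x2 <- comul x) (f x1 * g x2 : k^o).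
Proof. by rewrite linfunE //; lin. Qed.

Lemma dual_oneE x : dual_one x = counit x.
Proof. by rewrite linfunE //; lin. Qed.

Lemma dual_mul_linl g : linear (dual_mul^~ g).
Proof.
move=> a f h; apply/lfunP => x; rewrite add_lfunE scale_lfunE !dual_mulE.
have l : islin (fun e : dual C =>
  \tsum_(x1 ⊗ x2 <- comul x) (e x1 * g x2 : k^o)) by lin.
exact: l.
Qed.

Lemma dual_mul_linr f : linear (dual_mul f).
Proof.
move=> a g h; apply/lfunP => x; rewrite add_lfunE scale_lfunE !dual_mulE.
have l : islin (fun e : dual C =>
  \tsum_(x1 ⊗ x2 <- comul x) (f x1 * e x2 : k^o)) by lin.
exact: l.
Qed.

Lemma kmull_tsum (U V : vectType k) (t : tensor U V) (F : U -> V -> k^o)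
  (c : k^o) : tsum t F * c = \tsum_(u ⊗ v <- t) (F u v * c : k^o).
Proof. by rewrite (tsum_comp _ _ (g := fun z : k^o => z * c : k^o)) //; lin. Qed.

Lemma kmulr_tsum (U V : vectType k) (t : tensor U V) (F : U -> V -> k^o)
  (c : k^o) : c * tsum t F = \tsum_(u ⊗ v <- t) (c * F u v : k^o).
Proof. by rewrite (tsum_comp _ _ (g := fun z : k^o => c * z : k^o)) //; lin. Qed.

Lemma dual_mulA : associative dual_mul.
Proof.
move=> f g h; apply/lfunP => x; rewrite !dual_mulE.
have := @comulA_tsum k C k^o (fun a b c => f a * (g b * h c) : k^o) x.
move=> eq; transitivity
  (\tsum_(a ⊗ b <- comul x) \tsum_(b1 ⊗ b2 <- comul b)
     (f a * (g b1 * h b2) : k^o)).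
  by apply: eq_tsum => a b; rewrite dual_mulE kmulr_tsum.
rewrite -eq; [|by lin..].
apply: eq_tsum => a b; rewrite dual_mulE kmull_tsum.
by apply: eq_tsum => a1 a2; rewrite mulrA.
Qed.

Lemma dual_mul1l : left_id dual_one dual_mul.
Proof.
move=> f; apply/lfunP => x; rewrite dual_mulE -[in RHS](counitl x) dual_tsum.
by apply: eq_tsum => a b; rewrite dual_oneE linearZ.
Qed.

Lemma dual_mul1r : right_id dual_one dual_mul.
Proof.
move=> f; apply/lfunP => x; rewrite dual_mulE -[in RHS](counitr x) dual_tsum.
by apply: eq_tsum => a b; rewrite dual_oneE linearZ /GRing.scale /= mulrC.
Qed.

HB.instance Definition _ := isFdAlgebra.Build k (dual C)
  dual_mul_linl dual_mul_linr dual_mulA dual_mul1l dual_mul1r.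

End DualAlgebra.

Section DualCoalgebra.
Variables (k : fieldType) (A : fdAlgType k).
Implicit Types f : dual A.

(* The unique element \sum f1 ⊗ f2 with f (x ⋅ y) = \sum f1 x * f2 y for all *)
(* x and y (lemma dual_comulE), written in the dual basis.                    *)
Definition dual_comul f : tensor (dual A) (dual A) :=
  \sum_(i < \dim {:A}) \sum_(j < \dim {:A})
    f ((vbasis {:A})`_i ⋅ (vbasis {:A})`_j) *: (dual_vec i ⊗ dual_vec j).

Definition dual_counit f : k^o := f alg_one.

Lemma dual_comul_islin : linear dual_comul.
Proof.
move=> a f g; rewrite /dual_comul scaler_sumr -big_split; apply: eq_bigr => i _.
rewrite scaler_sumr -big_split; apply: eq_bigr => j _ /=.
by rewrite add_lfunE scale_lfunE scalerDl scalerA.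
Qed.

Lemma dual_counit_islin : linear dual_counit.
Proof. by move=> a f g; rewrite /dual_counit add_lfunE scale_lfunE. Qed.

HB.instance Definition _ := GRing.isLinear.Build k _ _ *:%R dual_comul
  dual_comul_islin.
HB.instance Definition _ := GRing.isLinear.Build k _ _ *:%R dual_counit
  dual_counit_islin.

Lemma dual_comulE f x y :
  \tsum_(f1 ⊗ f2 <- dual_comul f) (f1 x * f2 y : k^o) = f (x ⋅ y).
Proof.
pose F (t : tensor (dual A) (dual A)) :=
  \tsum_(f1 ⊗ f2 <- t) (f1 x * f2 y : k^o).
have lF : islin F by rewrite /F; lin.
pose FL := GRing.isLinear.Build k _ _ *:%R _ lF.
pose g : {linear tensor (dual A) (dual A) -> k^o} := HB.pack F FL.
rewrite -[LHS]/(g _) linear_sum.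
rewrite [x in RHS](coord_vbasis (memvf x)) [y in RHS](coord_vbasis (memvf y)).
pose GL (z : A) := GRing.isLinear.Build k _ _ *:%R _ (alg_mul_linl z).
pose gl z : {linear A -> A} := HB.pack (alg_mul^~ z) (GL z).
pose GR (z : A) := GRing.isLinear.Build k _ _ *:%R _ (alg_mul_linr z).
pose gr z : {linear A -> A} := HB.pack (alg_mul z) (GR z).
rewrite -[X in f X]/(gl _ _) !linear_sum; apply: eq_bigr => i _.
rewrite linear_sum -[gl _ _]/(gr _ _) !linear_sum; apply: eq_bigr => j _.
rewrite linearZ /= scale_mull scale_mulr !linearZ /=.
rewrite /F; tens; rewrite !dual_vecE /GRing.scale /=.
by rewrite mulrC -mulrA.
Qed.

Lemma dual_comulA : coassociative dual_comul.
Proof.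
move=> f; apply: dual_tens3_ext => x y z.
rewrite !tsum_tsum.
transitivity (f (x ⋅ y ⋅ z)); last first.
  rewrite -alg_mulA -dual_comulE; apply: eq_tsum => a b.
  by tens; rewrite -kmulr_tsum dual_comulE.
rewrite -dual_comulE; apply: eq_tsum => a b.
rewrite tsum_tsum -dual_comulE kmull_tsum; apply: eq_tsum => a1 a2.
by tens; tens; rewrite mulrA.
Qed.

Lemma dual_counitl : left_counit dual_comul dual_counit.
Proof.
move=> f; apply/lfunP => x; rewrite -[x in RHS]alg_mul1l -dual_comulE.
rewrite (tsum_comp _ _ (g := fun h : dual A => h x : k^o)) /=; last by lin.
by apply: eq_tsum => a b; rewrite scale_lfunE.
Qed.

Lemma dual_counitr : right_counit dual_comul dual_counit.
Proof.
move=> f; apply/lfunP => x; rewrite -[x in RHS]alg_mul1r -dual_comulE.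
rewrite (tsum_comp _ _ (g := fun h : dual A => h x : k^o)) /=; last by lin.
by apply: eq_tsum => a b; rewrite scale_lfunE /GRing.scale /= mulrC.
Qed.

HB.instance Definition _ := isCoalgebra.Build k (dual A)
  dual_comulA dual_counitl dual_counitr.

End DualCoalgebra.

Section BialgTheory.
Variables (k : fieldType) (H : bialgType k).

Lemma comulM_tsum (W : lmodType k) (F : H -> H -> W) x y :
    (forall b, islin (F^~ b)) -> (forall a, islin (F a)) ->
  \tsum_(a ⊗ b <- comul (x ⋅ y)) F a b =
  \tsum_(x1 ⊗ x2 <- comul x) \tsum_(y1 ⊗ y2 <- comul y) F (x1 ⋅ y1) (x2 ⋅ y2).
Proof.
move=> l1 l2; rewrite comulM tsum_tsum; apply: eq_tsum => x1 x2.
by rewrite tsum_tsum; apply: eq_tsum => y1 y2; tens.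
Qed.

Lemma comul1_tsum (W : lmodType k) (F : H -> H -> W) :
    (forall b, islin (F^~ b)) -> (forall a, islin (F a)) ->
  \tsum_(a ⊗ b <- comul (alg_one : H)) F a b = F alg_one alg_one.
Proof. by move=> l1 l2; rewrite comul1; tens. Qed.

Implicit Types f g : dual H.

Lemma dual_mul_algE f g x :
  (f ⋅ g) x = \tsum_(x1 ⊗ x2 <- comul x) (f x1 * g x2 : k^o).
Proof. exact: dual_mulE. Qed.

Lemma dual_comulM f g : comul (f ⋅ g) =
  \tsum_(f1 ⊗ f2 <- comul f) \tsum_(g1 ⊗ g2 <- comul g)
    ((f1 ⋅ g1) ⊗ (f2 ⋅ g2)).
Proof.
apply: dual_tens2_ext => x y.
rewrite dual_comulE dual_mulE comulM_tsum; [|by lin..].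
rewrite tsum_tsum.
transitivity (\tsum_(f1 ⊗ f2 <- comul f) \tsum_(g1 ⊗ g2 <- comul g)
  \tsum_(x1 ⊗ x2 <- comul x) \tsum_(y1 ⊗ y2 <- comul y)
    (((f1 x1 * f2 y1) * (g1 x2 * g2 y2)) : k^o)); last first.
  apply: eq_tsum => f1 f2; rewrite tsum_tsum; apply: eq_tsum => g1 g2.
  tens; rewrite !dual_mul_algE kmull_tsum; apply: eq_tsum => x1 x2.
  by rewrite kmulr_tsum; apply: eq_tsum => y1 y2; rewrite mulrACA.
transitivity (\tsum_(x1 ⊗ x2 <- comul x) \tsum_(y1 ⊗ y2 <- comul y)
   \tsum_(f1 ⊗ f2 <- comul f) \tsum_(g1 ⊗ g2 <- comul g)
    (((f1 x1 * f2 y1) * (g1 x2 * g2 y2)) : k^o)).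
  apply: eq_tsum => x1 x2; apply: eq_tsum => y1 y2.
  rewrite -!dual_comulE kmull_tsum; apply: eq_tsum => f1 f2.
  by rewrite kmulr_tsum.
transitivity (\tsum_(x1 ⊗ x2 <- comul x) \tsum_(f1 ⊗ f2 <- comul f)
   \tsum_(y1 ⊗ y2 <- comul y) \tsum_(g1 ⊗ g2 <- comul g)
    (((f1 x1 * f2 y1) * (g1 x2 * g2 y2)) : k^o)).
  by apply: eq_tsum => x1 x2; rewrite tsum_swap.
rewrite tsum_swap; apply: eq_tsum => f1 f2.
rewrite [RHS]tsum_swap; apply: eq_tsum => x1 x2.
by rewrite tsum_swap.
Qed.

Lemma dual_comul1 : comul (alg_one : dual H) = alg_one ⊗ alg_one.
Proof.
apply: dual_tens2_ext => x y; rewrite dual_comulE; tens.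
by rewrite !dual_oneE counitM.
Qed.

Lemma dual_counitM f g : counit (f ⋅ g) = counit f * counit g.
Proof.
rewrite -[LHS]/((f ⋅ g) alg_one) dual_mul_algE comul1_tsum //; lin.
Qed.

Lemma dual_counit1 : counit (alg_one : dual H) = 1.
Proof. by rewrite -[LHS]/((alg_one : dual H) alg_one) dual_oneE counit1. Qed.

HB.instance Definition _ := isBialgebra.Build k (dual H)
  dual_comulM dual_comul1 dual_counitM dual_counit1.

End BialgTheory.

Section DualHopf.
Variables (k : fieldType) (H : hopfAlgType k).
Implicit Types f : dual H.

Definition dual_antipode f : dual H := linfun (fun x => f (antipode x)).

Lemma dual_antipodeE f x : dual_antipode f x = f (antipode x).
Proof. by rewrite linfunE //; lin. Qed.

Lemma dual_antipode_islin : linear dual_antipode.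
Proof.
move=> a f g; apply/lfunP => x.
by rewrite add_lfunE scale_lfunE !dual_antipodeE add_lfunE scale_lfunE.
Qed.

HB.instance Definition _ := GRing.isLinear.Build k _ _ *:%R dual_antipode
  dual_antipode_islin.

Lemma dual_antipodel f :
  \tsum_(f1 ⊗ f2 <- comul f) (dual_antipode f1 ⋅ f2) = counit f *: (alg_one : dual H).
Proof.
apply/lfunP => x; rewrite scale_lfunE dual_oneE.
rewrite (tsum_comp _ _ (g := fun h : dual H => h x : k^o)) /=; last by lin.
transitivity (\tsum_(x1 ⊗ x2 <- comul x) (f (antipode x1 ⋅ x2) : k^o)).
  transitivity (\tsum_(f1 ⊗ f2 <- comul f) \tsum_(x1 ⊗ x2 <- comul x)
      (f1 (antipode x1) * f2 x2 : k^o)).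
    apply: eq_tsum => f1 f2; rewrite dual_mul_algE; apply: eq_tsum => x1 x2.
    by rewrite dual_antipodeE.
  by rewrite tsum_swap; apply: eq_tsum => x1 x2; rewrite dual_comulE.
by rewrite -dual_tsum antipodel linearZ /GRing.scale /= mulrC.
Qed.

Lemma dual_antipoder f :
  \tsum_(f1 ⊗ f2 <- comul f) (f1 ⋅ dual_antipode f2) = counit f *: (alg_one : dual H).
Proof.
apply/lfunP => x; rewrite scale_lfunE dual_oneE.
rewrite (tsum_comp _ _ (g := fun h : dual H => h x : k^o)) /=; last by lin.
transitivity (\tsum_(x1 ⊗ x2 <- comul x) (f (x1 ⋅ antipode x2) : k^o)).
  transitivity (\tsum_(f1 ⊗ f2 <- comul f) \tsum_(x1 ⊗ x2 <- comul x)
      (f1 x1 * f2 (antipode x2) : k^o)).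
    apply: eq_tsum => f1 f2; rewrite dual_mul_algE; apply: eq_tsum => x1 x2.
    by rewrite dual_antipodeE.
  by rewrite tsum_swap; apply: eq_tsum => x1 x2; rewrite dual_comulE.
by rewrite -dual_tsum antipoder linearZ /GRing.scale /= mulrC.
Qed.

HB.instance Definition _ := hasAntipode.Build k (dual H)
  dual_antipodel dual_antipoder.

End DualHopf.

Section ComoduleTheory.
Variables (k : fieldType) (H : coalgType k) (V : comodType H).

Lemma coactA_tsum (W : lmodType k) (F : V -> H -> H -> W) v :
  (forall b c, islin (fun a => F a b c)) ->
  (forall a c, islin (fun b => F a b c)) ->
  (forall a b, islin (fun c => F a b c)) ->
  \tsum_(a ⊗ b <- coact v) \tsum_(a0 ⊗ a1 <- coact a) F a0 a1 b =
  \tsum_(a ⊗ b <- coact v) \tsum_(b1 ⊗ b2 <- comul b) F a b1 b2.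
Proof.
move=> l1 l2 l3.
have := congr1 (fun t => \tsum_(a ⊗ bc <- t) \tsum_(b ⊗ c <- bc) F a b c)
  (coactA v).
rewrite /= !tsum_tsum => eq; etransitivity; [|etransitivity; [exact: eq|]].
  apply: eq_tsum => a b; rewrite tsum_tsum; apply: eq_tsum => a1 a2.
  by tens; tens.
by apply: eq_tsum => a b; tens.
Qed.

Lemma tens_ext (U W : vectType k) (X : lmodType k) (F G : tensor U W -> X) :
  islin F -> islin G -> (forall u w, F (u ⊗ w) = G (u ⊗ w)) -> F =1 G.
Proof.
move=> lF lG eq t; rewrite -[t]tsum_tensK (tsum_comp _ _ lF) (tsum_comp _ _ lG).
exact: eq_tsum.
Qed.

End ComoduleTheory.

Section ComodTensor.
Variables (k : fieldType) (H : bialgType k).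

Lemma triv_tens_islin : linear (fun c : k^o => c ⊗ (alg_one : H)).
Proof. exact: tens_linl. Qed.

(* the unit object of the category of right H-comodules *)
Definition triv_coact (c : k^o) : tensor k^o H := c ⊗ alg_one.

HB.instance Definition _ := GRing.isLinear.Build k _ _ *:%R triv_coact
  triv_tens_islin.

Lemma triv_coactA : coaction_assoc triv_coact.
Proof. by move=> c; rewrite /triv_coact; do !tens; rewrite comul1. Qed.

Lemma triv_coact_counit : coaction_counit triv_coact.
Proof. by move=> c; rewrite /triv_coact; tens; rewrite counit1 scale1r. Qed.

HB.instance Definition _ := isComodule.Build k H k^o
  triv_coactA triv_coact_counit.

Variables U V : comodType H.

Definition tens_coact (t : tensor U V) : tensor (tensor U V) H :=
  \tsum_(u ⊗ v <- t) \tsum_(u0 ⊗ u1 <- coact u) \tsum_(v0 ⊗ v1 <- coact v)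
    ((u0 ⊗ v0) ⊗ (u1 ⋅ v1)).

Lemma tens_coact_islin : linear tens_coact.
Proof. by apply: islin_tsum; lin. Qed.

HB.instance Definition _ := GRing.isLinear.Build k _ _ *:%R tens_coact
  tens_coact_islin.

Lemma tens_coactE u v : tens_coact (u ⊗ v) =
  \tsum_(u0 ⊗ u1 <- coact u) \tsum_(v0 ⊗ v1 <- coact v)
    ((u0 ⊗ v0) ⊗ (u1 ⋅ v1)).
Proof. by rewrite /tens_coact; tens. Qed.

Lemma tens_coactA : coaction_assoc tens_coact.
Proof.
apply: tens_ext => [||u v]; [by lin..|].
rewrite tens_coactE !tsum_tsum.
transitivity (\tsum_(u0 ⊗ u1 <- coact u) \tsum_(u1 ⊗ u2 <- comul u1)
  \tsum_(v0 ⊗ v1 <- coact v) \tsum_(v1 ⊗ v2 <- comul v1)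
     ((u0 ⊗ v0) ⊗ ((u1 ⋅ v1) ⊗ (u2 ⋅ v2)))); last first.
  apply: eq_tsum => u0 u1; rewrite tsum_tsum tsum_swap.
  apply: eq_tsum => v0 v1; tens; rewrite comulM tensr_tsum.
  by apply: eq_tsum => x1 x2; rewrite tensr_tsum.
rewrite -(coactA_tsum (F := fun u0 u1 u2 => \tsum_(v0 ⊗ v1 <- coact v)
    \tsum_(v1 ⊗ v2 <- comul v1) ((u0 ⊗ v0) ⊗ ((u1 ⋅ v1) ⊗ (u2 ⋅ v2)))));
  [|by lin..].
apply: eq_tsum => u0 u1; rewrite tsum_tsum.
transitivity (\tsum_(a0 ⊗ a1 <- coact u0) \tsum_(v0 ⊗ v1 <- coact v)
    \tsum_(w0 ⊗ w1 <- coact v0) ((a0 ⊗ w0) ⊗ ((a1 ⋅ w1) ⊗ (u1 ⋅ v1)))).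
  rewrite [RHS]tsum_swap; apply: eq_tsum => v0 v1.
  tens; rewrite tens_coactE tsum_tsum; apply: eq_tsum => a0 a1.
  by rewrite tsum_tsum; apply: eq_tsum => w0 w1; tens.
apply: eq_tsum => a0 a1.
by rewrite (coactA_tsum (F := fun w0 w1 v1 =>
  (a0 ⊗ w0) ⊗ ((a1 ⋅ w1) ⊗ (u1 ⋅ v1)))) //; lin.
Qed.

Lemma tens_coact_counit : coaction_counit tens_coact.
Proof.
apply: tens_ext => [||u v]; [by lin..|].
rewrite tens_coactE tsum_tsum -[u in RHS]coact_counit -[v in RHS]coact_counit.
rewrite tensl_tsum; apply: eq_tsum => u0 u1.
rewrite tsum_tsum tensr_tsum; apply: eq_tsum => v0 v1.
by tens; rewrite counitM scale_tensl scale_tensr scalerA.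
Qed.

HB.instance Definition _ := isComodule.Build k H (tensor U V)
  tens_coactA tens_coact_counit.

End ComodTensor.

Definition colinear (k : fieldType) (H : coalgType k) (U V : comodType H)
    (f : U -> V) := forall u,
  coact (f u) = \tsum_(u0 ⊗ u1 <- coact u) (f u0 ⊗ u1).

Definition bimodule_morphism (k : fieldType) (A : fdAlgType k)
    (δ : A -> tensor A A) : Prop :=
  (forall a b, δ (a ⋅ b) = \tsum_(b1 ⊗ b2 <- δ b) ((a ⋅ b1) ⊗ b2)) /\
  (forall a b, δ (a ⋅ b) = \tsum_(a1 ⊗ a2 <- δ a) (a1 ⊗ (a2 ⋅ b))).

(* A right H-comodule algebra A is a Frobenius algebra in the category of     *)
(* right H-comodules if it has a coalgebra structure in this category, i.e.   *)
(* one with H-colinear comultiplication and counit, whose comultiplication is *)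
(* a morphism of A,A-bimodules. Here A ⊗ A and k are the comodules of the     *)
(* monoidal structure (tens_coact and triv_coact).                            *)
Definition frobenius_in_comod (k : fieldType) (H : bialgType k)
    (A : comodAlgType H) : Prop :=
  exists (δ : {linear A -> tensor A A}) (ε : {linear A -> k^o}),
    [/\ coassociative δ, left_counit δ ε & right_counit δ ε] /\
    [/\ colinear (H := H) δ, colinear (H := H) ε & bimodule_morphism δ].

Arguments frobenius_in_comod {k} H A.

Definition dual_act (k : fieldType) (H : coalgType k) (V : comodType H)
    (f : dual H) (v : V) : V :=
  \tsum_(v0 ⊗ v1 <- coact v) ((f v1 : k) *: v0).

Notation "f ⇀ v" := (dual_act f v) : ring_scope.

Definition smash (k : fieldType) (H : bialgType k) (A : comodAlgType H) :=
  tensor A (dual H).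

HB.instance Definition _ (k : fieldType) (H : bialgType k)
    (A : comodAlgType H) := Vector.on (smash A).

Section ComodAlgTheory.
Variables (k : fieldType) (H : bialgType k) (A : comodAlgType H).
Implicit Types (a b : A) (f g : dual H).

Lemma coactM_tsum (W : lmodType k) (F : A -> H -> W) a b :
    (forall y, islin (F^~ y)) -> (forall x, islin (F x)) ->
  \tsum_(x ⊗ y <- coact (a ⋅ b)) F x y =
  \tsum_(a0 ⊗ a1 <- coact a) \tsum_(b0 ⊗ b1 <- coact b) F (a0 ⋅ b0) (a1 ⋅ b1).
Proof.
move=> l1 l2; rewrite coactM tsum_tsum; apply: eq_tsum => x1 x2.
by rewrite tsum_tsum; apply: eq_tsum => y1 y2; tens.
Qed.

Lemma islin_actl (U : lmodType k) (h : U -> dual H) (a : A) :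
  islin h -> islin (fun x => h x ⇀ a).
Proof. by rewrite /dual_act => lh; lin. Qed.

Lemma islin_actr (U : lmodType k) (f : dual H) (h : U -> A) :
  islin h -> islin (fun x => f ⇀ h x).
Proof. by rewrite /dual_act => lh; lin. Qed.

Lemma act_act f g a : f ⇀ (g ⇀ a) = (f ⋅ g) ⇀ a.
Proof.
rewrite /dual_act map_tsum tsum_tsum.
transitivity (\tsum_(a0 ⊗ a1 <- coact a) \tsum_(x ⊗ y <- comul a1)
  ((f x * g y : k) *: a0)); last first.
  by apply: eq_tsum => a0 a1; rewrite dual_mul_algE scalel_tsum.
rewrite -(coactA_tsum (F := fun a0 x y => (f x * g y : k) *: a0)); [|by lin..].
apply: eq_tsum => a0 a1; rewrite linearZ /= (islinZ (tsum_islin _)) scaler_tsum.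
by apply: eq_tsum => b0 b1; rewrite scalerA mulrC.
Qed.

Lemma act1 a : (alg_one : dual H) ⇀ a = a.
Proof.
rewrite -[RHS]coact_counit; apply: eq_tsum => a0 a1.
by rewrite dual_oneE.
Qed.

Lemma act_one f : f ⇀ (alg_one : A) = (counit f : k) *: (alg_one : A).
Proof. by rewrite /dual_act coact1; tens. Qed.

Lemma act_mul f a b :
  f ⇀ (a ⋅ b) = \tsum_(f1 ⊗ f2 <- comul f) ((f1 ⇀ a) ⋅ (f2 ⇀ b)).
Proof.
rewrite /dual_act coactM_tsum; [|by lin..].
transitivity (\tsum_(f1 ⊗ f2 <- comul f) \tsum_(a0 ⊗ a1 <- coact a)
  \tsum_(b0 ⊗ b1 <- coact b) ((f1 a1 * f2 b1 : k) *: (a0 ⋅ b0))); last first.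
  apply: eq_tsum => f1 f2; rewrite mull_tsum; apply: eq_tsum => a0 a1.
  rewrite mulr_tsum; apply: eq_tsum => b0 b1.
  by rewrite scale_mull scale_mulr scalerA.
rewrite [RHS]tsum_swap; apply: eq_tsum => a0 a1.
rewrite [RHS]tsum_swap; apply: eq_tsum => b0 b1.
by rewrite -scalel_tsum dual_comulE.
Qed.

End ComodAlgTheory.

Ltac lin1 ::= first
  [ exact: islin_id | match goal with H : _ |- _ => exact: H end
  | exact: islin_linear
  | apply: islin_tsumF => ? ?; solve [lin1]
  | apply: islin_tsum; solve [lin1]
  | apply: islin_tensl; solve [lin1]
  | apply: islin_tensr; solve [lin1]
  | apply: islin_mull; solve [lin1]
  | apply: islin_mulr; solve [lin1]
  | apply: islin_kmull; solve [lin1]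
  | apply: islin_kmulr; solve [lin1]
  | apply: islin_scalel; solve [lin1]
  | apply: islin_scaler; solve [lin1]
  | apply: islin_actl; solve [lin1]
  | apply: islin_actr; solve [lin1]
  | apply: islin_map; solve [lin1]
  | apply: islin_lfun; solve [lin1]
  | apply: islin_lfunv; solve [lin1] ].

Section Smash.
Variables (k : fieldType) (H : bialgType k) (A : comodAlgType H).
Implicit Types (s t : smash A) (a b c : A) (f g h : dual H).

Definition smash_mul s t : smash A :=
  \tsum_(a ⊗ f <- s) \tsum_(b ⊗ g <- t) \tsum_(f1 ⊗ f2 <- comul f)
    ((a ⋅ (f1 ⇀ b)) ⊗ (f2 ⋅ g)).

Definition smash_one : smash A := alg_one ⊗ alg_one.

Definition smash_coact t : tensor (smash A) (dual H) :=
  \tsum_(a ⊗ f <- t) \tsum_(f1 ⊗ f2 <- comul f)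
    ((a ⊗ f1 : smash A) ⊗ f2).

Lemma smash_mul_linl t : linear (smash_mul^~ t).
Proof. by apply: islin_tsum; lin. Qed.

Lemma smash_mul_linr s : linear (smash_mul s).
Proof. by apply: islin_tsumF => a f; lin. Qed.

Lemma smash_mulE a b f g : smash_mul (a ⊗ f) (b ⊗ g) =
  \tsum_(f1 ⊗ f2 <- comul f) ((a ⋅ (f1 ⇀ b)) ⊗ (f2 ⋅ g)).
Proof. by rewrite /smash_mul; tens; tens. Qed.

Lemma smash_mull_tsum (U V : vectType k) (s : tensor U V)
    (F : U -> V -> smash A) t :
  smash_mul (tsum s F) t = \tsum_(u ⊗ v <- s) smash_mul (F u v) t.
Proof. exact: (tsum_comp _ _ (@smash_mul_linl t)). Qed.

Lemma smash_mulr_tsum (U V : vectType k) (s : tensor U V)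
    (F : U -> V -> smash A) t :
  smash_mul t (tsum s F) = \tsum_(u ⊗ v <- s) smash_mul t (F u v).
Proof. exact: (tsum_comp _ _ (@smash_mul_linr t)). Qed.

Lemma smash_mulA_tens a b c f g h :
  smash_mul (a ⊗ f) (smash_mul (b ⊗ g) (c ⊗ h)) =
  smash_mul (smash_mul (a ⊗ f) (b ⊗ g)) (c ⊗ h).
Proof.
rewrite !smash_mulE smash_mulr_tsum smash_mull_tsum.
transitivity (\tsum_(f1 ⊗ f2 <- comul f) \tsum_(p ⊗ q <- comul f2)
  \tsum_(g1 ⊗ g2 <- comul g)
   ((a ⋅ (f1 ⇀ b) ⋅ ((p ⋅ g1) ⇀ c)) ⊗ (q ⋅ g2 ⋅ h))); last first.
  apply: eq_tsum => f1 f2; rewrite smash_mulE.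
  by rewrite [RHS]comulM_tsum; [|by lin..].
rewrite -(comulA_tsum (F := fun f1 p q => \tsum_(g1 ⊗ g2 <- comul g)
   ((a ⋅ (f1 ⇀ b) ⋅ ((p ⋅ g1) ⇀ c)) ⊗ (q ⋅ g2 ⋅ h)))); [|by lin..].
transitivity (\tsum_(g1 ⊗ g2 <- comul g) \tsum_(f1 ⊗ q <- comul f)
  \tsum_(f1 ⊗ p <- comul f1)
   ((a ⋅ (f1 ⇀ b) ⋅ ((p ⋅ g1) ⇀ c)) ⊗ (q ⋅ g2 ⋅ h))); last first.
  by rewrite tsum_swap; apply: eq_tsum => f1 f2; rewrite tsum_swap.
apply: eq_tsum => g1 g2; rewrite smash_mulE; apply: eq_tsum => f1 f2.
rewrite act_mul mulr_tsum tensl_tsum; apply: eq_tsum => p q.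
by rewrite act_act !alg_mulA.
Qed.

Lemma smash_mulA : associative smash_mul.
Proof.
move=> s t u.
have ll := smash_mul_linl; have lr := smash_mul_linr.
apply: (tens_ext (F := fun s => smash_mul s (smash_mul t u))
  (G := fun s => smash_mul (smash_mul s t) u)) => [||a f].
- exact: ll.
- by apply: islin_comp (ll u) (ll t).
apply: (tens_ext (F := fun t => smash_mul (a ⊗ f) (smash_mul t u))
  (G := fun t => smash_mul (smash_mul (a ⊗ f) t) u)) => [||b g].
- exact: islin_comp (lr _) (ll u).
- by apply: islin_comp (ll u) (lr _).
apply: (tens_ext (F := fun u => smash_mul (a ⊗ f) (smash_mul (b ⊗ g) u))
  (G := fun u => smash_mul (smash_mul (a ⊗ f) (b ⊗ g)) u)) => [||c h].
- exact: islin_comp (lr _) (lr _).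
- exact: lr.
exact: smash_mulA_tens.
Qed.

Lemma smash_mul1l : left_id smash_one smash_mul.
Proof.
apply: tens_ext => [||a f]; [exact: smash_mul_linr | by [] |].
rewrite smash_mulE comul1_tsum; [|by lin..].
by rewrite act1 !alg_mul1l.
Qed.

Lemma smash_mul1r : right_id smash_one smash_mul.
Proof.
apply: tens_ext => [||a f]; [exact: smash_mul_linl | by [] |].
rewrite smash_mulE -[f in RHS]counitl tensr_tsum; apply: eq_tsum => f1 f2.
by rewrite act_one scale_mulr !alg_mul1r scale_tensl scale_tensr.
Qed.

HB.instance Definition _ := isFdAlgebra.Build k (smash A)
  smash_mul_linl smash_mul_linr smash_mulA smash_mul1l smash_mul1r.

Lemma smash_coact_islin : linear smash_coact.
Proof. by apply: islin_tsum; lin. Qed.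

HB.instance Definition _ := GRing.isLinear.Build k _ _ *:%R smash_coact
  smash_coact_islin.

Lemma smash_coactE a f : smash_coact (a ⊗ f) =
  \tsum_(f1 ⊗ f2 <- comul f) ((a ⊗ f1 : smash A) ⊗ f2).
Proof. by rewrite /smash_coact; tens. Qed.

Lemma smash_coactA : coaction_assoc smash_coact.
Proof.
apply: tens_ext => [||a f]; [by lin..|].
rewrite smash_coactE !tsum_tsum.
transitivity (\tsum_(f1 ⊗ f2 <- comul f) \tsum_(p ⊗ q <- comul f2)
   ((a ⊗ f1 : smash A) ⊗ (p ⊗ q))); last first.
  by apply: eq_tsum => f1 f2; tens; rewrite -tensr_tsum tsum_tensK.
rewrite -(comulA_tsum (F := fun f1 p q => (a ⊗ f1 : smash A) ⊗ (p ⊗ q)));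
  [|by lin..].
apply: eq_tsum => f1 f2; tens; rewrite smash_coactE tsum_tsum.
by apply: eq_tsum => p q; tens.
Qed.

Lemma smash_coact_counit : coaction_counit smash_coact.
Proof.
apply: tens_ext => [||a f]; [by lin | by [] |].
rewrite smash_coactE tsum_tsum -[f in RHS]counitr tensr_tsum.
by apply: eq_tsum => f1 f2; tens; rewrite scale_tensr.
Qed.

HB.instance Definition _ := isComodule.Build k (dual H) (smash A)
  smash_coactA smash_coact_counit.

Lemma smash_coactM s t : coact (s ⋅ t) =
  \tsum_(s0 ⊗ s1 <- coact s) \tsum_(t0 ⊗ t1 <- coact t)
    ((s0 ⋅ t0) ⊗ (s1 ⋅ t1)).
Proof.
have key a f b g : smash_coact (smash_mul (a ⊗ f) (b ⊗ g)) =
    \tsum_(s0 ⊗ s1 <- smash_coact (a ⊗ f))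
    \tsum_(t0 ⊗ t1 <- smash_coact (b ⊗ g))
      (((s0 : smash A) ⋅ (t0 : smash A)) ⊗ (s1 ⋅ t1)).
  rewrite smash_mulE !smash_coactE map_tsum tsum_tsum.
  transitivity (\tsum_(f1 ⊗ f2 <- comul f) \tsum_(p ⊗ q <- comul f1)
    \tsum_(g1 ⊗ g2 <- comul g)
      (((a ⋅ (p ⇀ b)) ⊗ (q ⋅ g1) : smash A) ⊗ (f2 ⋅ g2))); last first.
    apply: eq_tsum => f1 f2; tens; rewrite tsum_swap tsum_tsum.
    apply: eq_tsum => g1 g2; tens; rewrite -tensl_tsum.
    by congr (_ ⊗ _); rewrite -smash_mulE.
  rewrite (comulA_tsum (F := fun p q f2 => \tsum_(g1 ⊗ g2 <- comul g)
      (((a ⋅ (p ⇀ b)) ⊗ (q ⋅ g1) : smash A) ⊗ (f2 ⋅ g2)))); [|by lin..].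
  apply: eq_tsum => f1 f2; rewrite [LHS]smash_coactE.
  by rewrite [LHS]comulM_tsum; [|by lin..].
have ll := smash_mul_linl; have lr := smash_mul_linr.
have lc := smash_coact_islin.
apply: (tens_ext (F := fun s => smash_coact (smash_mul s t))
  (G := fun s => \tsum_(s0 ⊗ s1 <- smash_coact s)
    \tsum_(t0 ⊗ t1 <- smash_coact t) ((s0 ⋅ t0) ⊗ (s1 ⋅ t1)))) => [||a f].
- exact: islin_comp lc (ll t).
- by apply: islin_tsum.
apply: (tens_ext (F := fun t => smash_coact (smash_mul (a ⊗ f) t))
  (G := fun t => \tsum_(s0 ⊗ s1 <- smash_coact (a ⊗ f))
    \tsum_(t0 ⊗ t1 <- smash_coact t)
      (((s0 : smash A) ⋅ (t0 : smash A)) ⊗ (s1 ⋅ t1)))) => [||b g].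
- exact: islin_comp lc (lr _).
- by apply: islin_tsumF => s0 s1; apply: islin_tsum.
exact: key.
Qed.

Lemma smash_coact1 : coact (alg_one : smash A) = alg_one ⊗ alg_one.
Proof.
by rewrite -[LHS]/(smash_coact (_ ⊗ _)) smash_coactE comul1_tsum //; lin.
Qed.

HB.instance Definition _ := isComodAlgebra.Build k (dual H) (smash A)
  smash_coactM smash_coact1.

End Smash.

(* Main.v *)
(* A is Frobenius in the category of comodules iff it has a colinear form l   *)
(* and an invariant element e = \sum e' ⊗ e'' with a e = e a that is dual to  *)
(* l, i.e. \sum l(e') e'' = 1 = \sum l(e'') e'. By Larson and Sweedler, the   *)
(* Hopf algebra K = H* has such a pair (t, c) too: t is an integral and       *)
(* c = \sum L_1 ⊗ S(L_2) for a left integral L of K with t(L) = 1. Then A # K *)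
(* is a Frobenius extension of K through l # id, and composing it with (t, c) *)
(* gives the form l ⊗ t on A # K with the dual element                        *)
(* \sum (e' # c') ⊗ (1 # c'')(e'' # 1).                                       *)
From HB Require Import structures.
Require Import Defs.
From mathcomp Require Import all_boot all_order all_algebra.

Set Implicit Arguments.
Unset Strict Implicit.
Unset Printing Implicit Defensive.

Import GRing.Theory.
Local Open Scope ring_scope.

(** A comultiplication that is a bimodule map is r ↦ r D, where D is its value at 1 and satisfies r
    D = D r. A Frobenius structure in a category of comodules is therefore a pair of a colinear form
    l and a coinvariant such D, dual to each other ([frobenius_casimir],
    [frobenius_casimir_exists]).

    A finite dimensional Hopf algebra K has such a pair (t, c) for its own comultiplication
    ([hopf_frobenius]). Its dual is a Hopf module, so its elements are recovered from coinvariants;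
    these are integrals, hence a nonzero integral t exists ([haar_recover], [integral_exists]). The
    same Hopf module structure makes t nondegenerate ([lact_integral_inj]), which yields an integral
    L in K, and then c.

    With K the dual of H, the pair (l, e) of A combines with (t, c). Moving an element of K across e
    costs nothing, because coinvariance of e makes K act on it through the counit
    ([act_coinvariant]); likewise colinearity of l gives l (f ⇀ a) = ε(f) l(a). The coaction of A #
    K only sees K, so colinearity and coinvariance of the new pair come from t and c. *)

(** * Linear maps, dimension and dual bases *)

Section LinearPreliminaries.
Variable k : fieldType.

Lemma islin_sum (U V : lmodType k) (f : U -> V) (I : finType) (F : I -> U) :
  islin f -> f (\sum_i F i) = \sum_i f (F i).
Proof.
move=> lf; pose fm := GRing.isLinear.Build k U V *:%R f lf.
by pose g : {linear U -> V} := HB.pack f fm; apply: (linear_sum g).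
Qed.

Lemma islin0 (U V : lmodType k) (f : U -> V) : islin f -> f 0 = 0.
Proof. by move=> lf; rewrite -[X in f X](scale0r 0) (islinZ lf) scale0r. Qed.

Lemma tsum0 (U V : vectType k) (W : lmodType k) (t : tensor U V)
    (F : U -> V -> W) : (forall u v, F u v = 0) -> tsum t F = 0.
Proof.
by move=> F0; rewrite /tsum big1 // => i _; rewrite big1 // => j _;
  rewrite F0 scaler0.
Qed.

Lemma inj_islin_surj (U V : vectType k) (f : U -> V) :
    islin f -> (forall u, f u = 0 -> u = 0) -> dim U = dim V ->
  forall v, exists u, f u = v.
Proof.
move=> lf f0 dUV v; have fE := linfunE lf.
have k0 : lker (linfun f) == 0%VS.
  by rewrite -subv0; apply/subvP=> u; rewrite memv_ker fE memv0 => /eqP/f0->.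
have vf : v \in limg (linfun f).
  suff -> : limg (linfun f) = fullv by rewrite memvf.
  apply/eqP; rewrite eqEdim subvf limg_dim_eq ?(eqP k0) ?capv0 // !dimvf.
  by rewrite dUV /= leqnn.
by case/memv_imgP: vf => u _ ->; exists u; rewrite fE.
Qed.

Lemma dual_eq0 (V : vectType k) (v : V) : (forall f : dual V, f v = 0) -> v = 0.
Proof.
move=> v0; rewrite (coord_vbasis (memvf v)) big1 // => i _.
by rewrite -dual_vecE v0 scale0r.
Qed.

Lemma dim_dual (V : vectType k) : dim V = dim (dual V).
Proof. by rewrite [RHS]/dim /= muln1. Qed.

(** The canonical element, which represents the identity of V. It turns convolution by a functional
    into a coaction: m ↦ \sum m f ⊗ u. *)
Definition dual_bases (V : vectType k) : tensor (dual V) V :=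
  \sum_(i < \dim {:V}) dual_vec i ⊗ (vbasis {:V})`_i.

Lemma dual_basesE (V : vectType k) (v : V) :
  \tsum_(f ⊗ u <- dual_bases V) ((f v : k) *: u) = v.
Proof.
rewrite [LHS](islin_sum (f := fun t => tsum t (fun (f : dual V) u => (f v : k) *: u)));
  last by lin.
rewrite [RHS](coord_vbasis (memvf v)).
by apply: eq_bigr => i _ /=; tens; rewrite dual_vecE.
Qed.

End LinearPreliminaries.

Section Counit.
Variables (k : fieldType) (C : coalgType k).
Implicit Type x : C.

Lemma counitl_tsum (W : lmodType k) (F : C -> W) x :
  islin F -> \tsum_(x1 ⊗ x2 <- comul x) ((counit x1 : k) *: F x2) = F x.
Proof.
move=> lF; rewrite -[in RHS](counitl x) (tsum_comp _ _ lF).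
by apply: eq_tsum => x1 x2; rewrite (islinZ lF).
Qed.

Lemma counitr_tsum (W : lmodType k) (F : C -> W) x :
  islin F -> \tsum_(x1 ⊗ x2 <- comul x) ((counit x2 : k) *: F x1) = F x.
Proof.
move=> lF; rewrite -[in RHS](counitr x) (tsum_comp _ _ lF).
by apply: eq_tsum => x1 x2; rewrite (islinZ lF).
Qed.

End Counit.

(** * Casimir elements *)

Section CasimirElement.
Variables (k : fieldType) (R : fdAlgType k).

Definition casimir (D : tensor R R) := forall r,
  \tsum_(x ⊗ y <- D) ((r ⋅ x) ⊗ y) = \tsum_(x ⊗ y <- D) (x ⊗ (y ⋅ r)).

Lemma casimir_tsum D (W : lmodType k) (F : R -> R -> W) r : casimir D ->
    (forall y, islin (F^~ y)) -> (forall x, islin (F x)) ->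
  \tsum_(x ⊗ y <- D) F (r ⋅ x) y = \tsum_(x ⊗ y <- D) F x (y ⋅ r).
Proof.
move=> cD l1 l2; have := congr1 (fun t => tsum t F) (cD r).
rewrite !tsum_tsum => eq; etransitivity; [|etransitivity; [exact: eq|]];
  by apply: eq_tsum => x y; rewrite tsum_tens.
Qed.

End CasimirElement.

(** * The antipode and the translation action on the dual *)

Section HopfTheory.
Variables (k : fieldType) (K : hopfAlgType k).
Implicit Types (x y z : K) (p q m : dual K).
Local Notation S := (antipode : K -> K).

Lemma antipodel_tsum (W : lmodType k) (F : K -> W) x : islin F ->
  \tsum_(x1 ⊗ x2 <- comul x) F (S x1 ⋅ x2) = (counit x : k) *: F alg_one.
Proof. by move=> lF; rewrite -(islinZ lF) -antipodel (tsum_comp _ _ lF). Qed.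

Lemma antipoder_tsum (W : lmodType k) (F : K -> W) x : islin F ->
  \tsum_(x1 ⊗ x2 <- comul x) F (x1 ⋅ S x2) = (counit x : k) *: F alg_one.
Proof. by move=> lF; rewrite -(islinZ lF) -antipoder (tsum_comp _ _ lF). Qed.

Lemma antipode1 : S alg_one = alg_one.
Proof.
rewrite -[LHS]alg_mul1l.
have := antipoder (alg_one : K); rewrite comul1_tsum; [|by lin..].
by rewrite counit1 scale1r.
Qed.

(** Both sides are convolution inverses of the multiplication K ⊗ K -> K; the middle term is S (x1
    y1) (x2 y2) (S y3 S x3). *)
Lemma antipodeM x y : S (x ⋅ y) = S y ⋅ S x.
Proof.
transitivity (\tsum_(x1 ⊗ x2 <- comul x) \tsum_(y1 ⊗ y2 <- comul y)
  \tsum_(x2 ⊗ x3 <- comul x2) \tsum_(y2 ⊗ y3 <- comul y2)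
    (S (x1 ⋅ y1) ⋅ ((x2 ⋅ y2) ⋅ (S y3 ⋅ S x3)))).
  rewrite -[LHS](counitr_tsum (F := fun x => S (x ⋅ y))); last by lin.
  apply: eq_tsum => x1 x2.
  rewrite -[in LHS](counitr_tsum (F := fun y => S (x1 ⋅ y))); last by lin.
  rewrite scaler_tsum; apply: eq_tsum => y1 y2.
  rewrite -[in LHS](alg_mul1r (S (x1 ⋅ y1))).
  rewrite -(antipoder_tsum (F := fun u =>
    (counit y2 : k) *: (S (x1 ⋅ y1) ⋅ u))); last by lin.
  apply: eq_tsum => x3 x4; rewrite -[in LHS](alg_mul1r x3).
  rewrite -(antipoder_tsum (F := fun u => S (x1 ⋅ y1) ⋅ (x3 ⋅ u ⋅ S x4)));
    last by lin.
  by apply: eq_tsum => y3 y4; rewrite !alg_mulA.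
under eq_tsum => x1 x2 do rewrite tsum_swap.
rewrite -(comulA_tsum (F := fun x1 x2 x3 => \tsum_(y1 ⊗ y2 <- comul y)
  \tsum_(y2 ⊗ y3 <- comul y2)
    (S (x1 ⋅ y1) ⋅ ((x2 ⋅ y2) ⋅ (S y3 ⋅ S x3))))); [|by lin..].
rewrite -[RHS](counitl_tsum (F := fun x => S y ⋅ S x)); last by lin.
apply: eq_tsum => x1 x2.
under eq_tsum => x3 x4.
  rewrite -(comulA_tsum (F := fun y1 y2 y3 =>
    S (x3 ⋅ y1) ⋅ ((x4 ⋅ y2) ⋅ (S y3 ⋅ S x2)))); [|by lin..].
  over.
rewrite tsum_swap.
rewrite -[in RHS](counitl_tsum (F := fun y => S y ⋅ S x2)); last by lin.
rewrite scaler_tsum; apply: eq_tsum => y1 y2.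
rewrite scalerA -counitM -[in RHS](alg_mul1l (S y2)) -alg_mulA.
rewrite -(antipodel_tsum (F := fun u => u ⋅ (S y2 ⋅ S x2))); last by lin.
rewrite comulM_tsum; [|by lin..].
by apply: eq_tsum => x3 x4; apply: eq_tsum => y3 y4; rewrite !alg_mulA.
Qed.

(** Evaluate \sum S x1 (x2 S x3)_1 ⊗ (x2 S x3)_2 by cancelling either x2 S x3, or S x1 against the
    next factor after expanding the comultiplication. This serves in place of the
    anti-comultiplicativity of S. *)
Lemma antipode_comulr x :
  \tsum_(x1 ⊗ x2 <- comul x) \tsum_(u ⊗ v <- comul (S x2)) (u ⊗ (x1 ⋅ v)) =
  S x ⊗ alg_one.
Proof.
transitivity (\tsum_(x1 ⊗ x2 <- comul x) \tsum_(a ⊗ b <- comul x2)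
  \tsum_(u ⊗ v <- comul (a ⋅ S b)) ((S x1 ⋅ u) ⊗ v)); last first.
  rewrite -[RHS](counitr_tsum (F := fun y => S y ⊗ alg_one)); last by lin.
  apply: eq_tsum => x1 x2.
  rewrite (antipoder_tsum (F := fun w =>
    \tsum_(u ⊗ v <- comul w) ((S x1 ⋅ u) ⊗ v))); last by lin.
  by rewrite comul1_tsum ?alg_mul1r //; lin.
transitivity (\tsum_(x1 ⊗ x2 <- comul x) \tsum_(a ⊗ b <- comul x2)
  \tsum_(a1 ⊗ a2 <- comul a) \tsum_(u ⊗ v <- comul (S b))
     ((S x1 ⋅ a1 ⋅ u) ⊗ (a2 ⋅ v))); last first.
  apply: eq_tsum => x1 x2; apply: eq_tsum => a b.
  rewrite comulM_tsum; [|by lin..].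
  by apply: eq_tsum => a1 a2; apply: eq_tsum => u v; rewrite alg_mulA.
transitivity (\tsum_(x1 ⊗ x2 <- comul x) \tsum_(a ⊗ b <- comul x1)
  \tsum_(a1 ⊗ a2 <- comul a) \tsum_(u ⊗ v <- comul (S x2))
     ((S a1 ⋅ a2 ⋅ u) ⊗ (b ⋅ v))).
  apply: eq_tsum => x1 x2.
  rewrite -[LHS](counitl_tsum (F := fun y => \tsum_(u ⊗ v <- comul (S x2))
    (u ⊗ (y ⋅ v)))); last by lin.
  apply: eq_tsum => a b.
  rewrite (antipodel_tsum (F := fun w => \tsum_(u ⊗ v <- comul (S x2))
    ((w ⋅ u) ⊗ (b ⋅ v)))); last by lin.
  by congr (_ *: _); apply: eq_tsum => u v; rewrite alg_mul1l.
rewrite -(comulA_tsum (F := fun x1 a b => \tsum_(a1 ⊗ a2 <- comul a)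
  \tsum_(u ⊗ v <- comul (S b)) ((S x1 ⋅ a1 ⋅ u) ⊗ (a2 ⋅ v)))); [|by lin..].
apply: eq_tsum => x1 x2.
by rewrite (comulA_tsum (F := fun a1 a2 b => \tsum_(u ⊗ v <- comul (S x2))
  ((S a1 ⋅ a2 ⋅ u) ⊗ (b ⋅ v)))); [|by lin..].
Qed.

(** The mirror argument, on \sum (S x1 x2)_1 ⊗ (S x1 x2)_2 S x3. *)
Lemma antipode_comull x :
  \tsum_(x1 ⊗ x2 <- comul x) \tsum_(u ⊗ v <- comul (S x1)) ((u ⋅ x2) ⊗ v) =
  alg_one ⊗ S x.
Proof.
transitivity (\tsum_(x1 ⊗ x2 <- comul x) \tsum_(a ⊗ b <- comul x1)
  \tsum_(u ⊗ v <- comul (S a ⋅ b)) (u ⊗ (v ⋅ S x2))); last first.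
  rewrite -[RHS](counitl_tsum (F := fun y => alg_one ⊗ S y)); last by lin.
  apply: eq_tsum => x1 x2.
  rewrite (antipodel_tsum (F := fun w =>
    \tsum_(u ⊗ v <- comul w) (u ⊗ (v ⋅ S x2)))); last by lin.
  by rewrite comul1_tsum ?alg_mul1l //; lin.
transitivity (\tsum_(x1 ⊗ x2 <- comul x) \tsum_(a ⊗ b <- comul x1)
  \tsum_(u ⊗ v <- comul (S a)) \tsum_(b1 ⊗ b2 <- comul b)
     ((u ⋅ b1) ⊗ (v ⋅ b2 ⋅ S x2))); last first.
  apply: eq_tsum => x1 x2; apply: eq_tsum => a b.
  by rewrite comulM_tsum; [|by lin..].
rewrite (comulA_tsum (F := fun a b x2 =>  \tsum_(u ⊗ v <- comul (S a))
  \tsum_(b1 ⊗ b2 <- comul b) ((u ⋅ b1) ⊗ (v ⋅ b2 ⋅ S x2)))); [|by lin..].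
apply: eq_tsum => x1 x2.
under [RHS]eq_tsum => a b do rewrite tsum_swap.
rewrite (comulA_tsum (F := fun b1 b2 c => \tsum_(u ⊗ v <- comul (S x1))
  ((u ⋅ b1) ⊗ (v ⋅ b2 ⋅ S c)))); [|by lin..].
rewrite -[LHS](counitr_tsum (F := fun y => \tsum_(u ⊗ v <- comul (S x1))
    ((u ⋅ y) ⊗ v))); last by lin.
apply: eq_tsum => a b.
transitivity (\tsum_(b1 ⊗ b2 <- comul b) \tsum_(u ⊗ v <- comul (S x1))
  ((u ⋅ a) ⊗ (v ⋅ (b1 ⋅ S b2)))); last first.
  by apply: eq_tsum => b1 b2; apply: eq_tsum => u v; rewrite alg_mulA.
rewrite (antipoder_tsum (F := fun w => \tsum_(u ⊗ v <- comul (S x1))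
    ((u ⋅ a) ⊗ (v ⋅ w)))); last by lin.
by congr (_ *: _); apply: eq_tsum => u v; rewrite alg_mul1r.
Qed.

(* S is used to make the right translation action of K on its dual a left     *)
(* one; with the coaction of lact_mul, dual K becomes a Hopf module whose     *)
(* coinvariants are the integrals.                                            *)
Definition lact x m : dual K := linfun (fun y => m (S x ⋅ y) : k^o).
Definition ltrans x p : dual K := linfun (fun y => p (x ⋅ y) : k^o).

Lemma lactE x m y : lact x m y = m (S x ⋅ y).
Proof. by rewrite linfunE //; lin. Qed.

Lemma ltransE x p y : ltrans x p y = p (x ⋅ y).
Proof. by rewrite linfunE //; lin. Qed.

Lemma islin_lactl m : islin (lact^~ m).
Proof.
by move=> a x y; apply/lfunP=> z; rewrite add_lfunE scale_lfunE !lactE linearP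
  alg_mul_linl linearP.
Qed.

Lemma islin_lactr x : islin (lact x).
Proof.
by move=> a p q; apply/lfunP=> z;
  rewrite add_lfunE scale_lfunE !lactE add_lfunE scale_lfunE.
Qed.

Lemma islin_ltransl p : islin (ltrans^~ p).
Proof.
by move=> a x y; apply/lfunP=> z; rewrite add_lfunE scale_lfunE !ltransE
  alg_mul_linl linearP.
Qed.

Lemma lactA x y m : lact x (lact y m) = lact (x ⋅ y) m.
Proof. by apply/lfunP=> z; rewrite !lactE antipodeM alg_mulA. Qed.

Lemma lact1 m : lact alg_one m = m.
Proof. by apply/lfunP=> z; rewrite lactE antipode1 alg_mul1l. Qed.

Lemma eval_tsum (U V X : vectType k) (t : tensor U V) (F : U -> V -> dual X) v :
  tsum t F v = \tsum_(x ⊗ y <- t) (F x y v : k^o).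
Proof. by rewrite (tsum_comp _ _ (g := fun h : dual X => h v : k^o)) //=; lin. Qed.

(** Pair with y and replace S x ⊗ 1 by the sum in [antipode_comulr]. This is the Hopf module
    compatibility of [lact] with the coaction given by convolution. *)
Lemma lact_mul x m p :
  lact x m ⋅ p = \tsum_(x1 ⊗ x2 <- comul x) lact x2 (m ⋅ ltrans x1 p).
Proof.
apply/lfunP=> y; rewrite dual_mul_algE eval_tsum.
transitivity (\tsum_(x1 ⊗ x2 <- comul x) \tsum_(u ⊗ v <- comul (S x2))
  \tsum_(y1 ⊗ y2 <- comul y) (m (u ⋅ y1) * p (x1 ⋅ v ⋅ y2) : k^o)).
  transitivity (\tsum_(a ⊗ b <- S x ⊗ (alg_one : K)) \tsum_(y1 ⊗ y2 <- comul y)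
     (m (a ⋅ y1) * p (b ⋅ y2) : k^o)).
    by tens; apply: eq_tsum => y1 y2; rewrite lactE alg_mul1l.
  rewrite -antipode_comulr tsum_tsum; apply: eq_tsum => x1 x2.
  by rewrite tsum_tsum; apply: eq_tsum => u v; tens.
apply: eq_tsum => x1 x2; rewrite lactE dual_mul_algE comulM_tsum; [|by lin..].
apply: eq_tsum => u v; apply: eq_tsum => y1 y2.
by rewrite ltransE alg_mulA.
Qed.

End HopfTheory.

Ltac lin1 ::= first
  [ exact: islin_id | match goal with H : _ |- _ => exact: H end
  | exact: islin_linear
  | apply: islin_tsumF => ? ?; solve [lin1]
  | apply: islin_tsum; solve [lin1]
  | apply: islin_tensl; solve [lin1]
  | apply: islin_tensr; solve [lin1]
  | apply: islin_mull; solve [lin1]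
  | apply: islin_mulr; solve [lin1]
  | apply: islin_kmull; solve [lin1]
  | apply: islin_kmulr; solve [lin1]
  | apply: islin_scalel; solve [lin1]
  | apply: islin_scaler; solve [lin1]
  | apply: islin_actl; solve [lin1]
  | apply: islin_actr; solve [lin1]
  | apply: islin_comp (islin_lactl _) _; solve [lin1]
  | apply: islin_comp (@islin_lactr _ _ _) _; solve [lin1]
  | apply: islin_comp (islin_ltransl _) _; solve [lin1]
  | apply: islin_map; solve [lin1]
  | apply: islin_lfun; solve [lin1]
  | apply: islin_lfunv; solve [lin1] ].

(** * Integrals and the Frobenius structure of a Hopf algebra *)

Section Integrals.
Variables (k : fieldType) (K : hopfAlgType k).
Implicit Types (x y z : K) (p q m t : dual K).
Local Notation S := (antipode : K -> K).

(* The projection of the Hopf module dual K onto its coinvariants. *)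
Definition haar m : dual K :=
  \tsum_(f ⊗ u <- dual_bases K) lact (S u) (m ⋅ f).

Lemma dual_bases_tsum (W : vectType k) (F : K -> W) v : islin F ->
  \tsum_(f ⊗ u <- dual_bases K) ((f v : k) *: F u) = F v.
Proof.
move=> lF; rewrite -[in RHS](dual_basesE v) (tsum_comp _ _ lF).
by apply: eq_tsum => f u; rewrite (islinZ lF).
Qed.

(** By [lact_mul] it suffices to compare two elements of dual K ⊗ K that do not involve m; evaluated
    at z, they agree by [antipode_comull]. *)
Lemma haar_integral m p : haar m ⋅ p = (counit p : k) *: haar m.
Proof.
rewrite mull_tsum.
transitivity (\tsum_(g ⊗ v <- \tsum_(f ⊗ u <- dual_bases K)
    \tsum_(u1 ⊗ u2 <- comul (S u)) ((f ⋅ ltrans u1 p) ⊗ u2))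
  lact v (m ⋅ g)).
  rewrite tsum_tsum; apply: eq_tsum => f u; rewrite lact_mul tsum_tsum.
  by apply: eq_tsum => u1 u2; tens; rewrite alg_mulA.
rewrite (_ : tsum _ _ = \tsum_(f ⊗ u <- dual_bases K)
    ((counit p : k) *: (f ⊗ S u))).
  rewrite tsum_tsum scaler_tsum; apply: eq_tsum => f u.
  by rewrite (islinZ (tsum_islin _)); tens.
apply: dual_tens_ext => z; rewrite !tsum_tsum.
transitivity (\tsum_(z1 ⊗ z2 <- comul z) \tsum_(u1 ⊗ u2 <- comul (S z1))
  ((p (u1 ⋅ z2) : k) *: u2)).
  transitivity (\tsum_(z1 ⊗ z2 <- comul z) \tsum_(f ⊗ u <- dual_bases K)
    ((f z1 : k) *: \tsum_(u1 ⊗ u2 <- comul (S u)) ((p (u1 ⋅ z2) : k) *: u2))).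
    rewrite tsum_swap; apply: eq_tsum => f u; rewrite tsum_tsum.
    transitivity (\tsum_(u1 ⊗ u2 <- comul (S u)) \tsum_(z1 ⊗ z2 <- comul z)
       ((f z1 * p (u1 ⋅ z2) : k) *: u2)).
      apply: eq_tsum => u1 u2; tens; rewrite dual_mul_algE scalel_tsum.
      by apply: eq_tsum => z1 z2; rewrite ltransE.
    rewrite tsum_swap; apply: eq_tsum => z1 z2; rewrite scaler_tsum.
    by apply: eq_tsum => u1 u2; rewrite scalerA.
  apply: eq_tsum => z1 z2.
  by rewrite (dual_bases_tsum (F := fun u => \tsum_(u1 ⊗ u2 <- comul (S u))
    ((p (u1 ⋅ z2) : k) *: u2))); last by lin.
transitivity (\tsum_(a ⊗ b <- (alg_one : K) ⊗ S z) ((p a : k) *: b)).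
  rewrite -antipode_comull tsum_tsum; apply: eq_tsum => z1 z2.
  by rewrite tsum_tsum; apply: eq_tsum => u1 u2; tens.
tens; rewrite -[S z in LHS](dual_bases_tsum (F := S)); last by lin.
rewrite scaler_tsum; apply: eq_tsum => f u.
by rewrite (islinZ (tsum_islin _)); tens.
Qed.

(** Half of the fundamental theorem of Hopf modules: the composite action is by \sum f g ⊗ u S v,
    whose value at z is \sum z1 S z2 = ε(z) 1. *)
Lemma haar_recover m :
  \tsum_(f ⊗ u <- dual_bases K) lact u (haar (m ⋅ f)) = m.
Proof.
transitivity (\tsum_(g ⊗ v <- \tsum_(f ⊗ u <- dual_bases K)
    \tsum_(g ⊗ v <- dual_bases K) ((f ⋅ g) ⊗ (u ⋅ S v)))
  lact v (m ⋅ g)).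
  rewrite tsum_tsum; apply: eq_tsum => f u; rewrite tsum_tsum.
  rewrite (tsum_comp _ _ (islin_lactr u)); apply: eq_tsum => g v.
  by tens; rewrite lactA alg_mulA.
rewrite (_ : tsum _ _ = (alg_one : dual K) ⊗ (alg_one : K)).
  by tens; rewrite lact1 alg_mul1r.
apply: dual_tens_ext => z; tens; rewrite dual_oneE -antipoder tsum_tsum.
transitivity (\tsum_(z1 ⊗ z2 <- comul z) \tsum_(f ⊗ u <- dual_bases K)
    ((f z1 : k) *: \tsum_(g ⊗ v <- dual_bases K) ((g z2 : k) *: (u ⋅ S v)))).
  rewrite [RHS]tsum_swap; apply: eq_tsum => f u; rewrite tsum_tsum.
  transitivity (\tsum_(g ⊗ v <- dual_bases K) \tsum_(z1 ⊗ z2 <- comul z)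
       ((f z1 * g z2 : k) *: (u ⋅ S v))).
    by apply: eq_tsum => g v; tens; rewrite dual_mul_algE scalel_tsum.
  rewrite tsum_swap; apply: eq_tsum => z1 z2; rewrite scaler_tsum.
  by apply: eq_tsum => u1 u2; rewrite scalerA.
apply: eq_tsum => z1 z2.
rewrite (dual_bases_tsum (F := fun u => \tsum_(g ⊗ v <- dual_bases K)
  ((g z2 : k) *: (u ⋅ S v)))); last by lin.
by rewrite (dual_bases_tsum (F := fun v => z1 ⋅ S v)); last by lin.
Qed.

Lemma integral_exists :
  exists2 t : dual K, t != 0 & forall p, t ⋅ p = (counit p : k) *: t.
Proof.
case: (pickP (fun i => haar (alg_one ⋅ dual_vec i) != 0)) => [i ne | e0].
  by exists (haar (alg_one ⋅ dual_vec i)) => // p; apply: haar_integral.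
have l : islin (fun f : dual K => haar (alg_one ⋅ f)) by rewrite /haar; lin.
have h0 f : haar (alg_one ⋅ f) = 0.
  rewrite -(dual_sum f) (islin_sum _ l) big1 // => i _.
  by rewrite (islinZ l) (eqP (negbFE (e0 i))) scaler0.
have := haar_recover alg_one.
rewrite tsum0 => [/lfunP/(_ alg_one)|f u]; last first.
  by rewrite h0 (islin0 (islin_lactr u)).
by rewrite lfunE dual_oneE counit1 => /esym/eqP; rewrite oner_eq0.
Qed.

(** From 0 = (x t) p = \sum p(x1) (x2 t) for all p, the tensor \sum x2 t ⊗ x1 vanishes. Cancelling
    x2 by an antipode leaves t(y) x = 0 for every y. *)
Lemma lact_integral_inj t x :
    t != 0 -> (forall p, t ⋅ p = (counit p : k) *: t) ->
  lact x t = 0 -> x = 0.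
Proof.
move=> t0 ti xt0.
have T0 : \tsum_(x1 ⊗ x2 <- comul x) (lact x2 t ⊗ x1) = 0.
  apply: dual_tens_ext => v; rewrite tsum_tsum.
  rewrite (islin0 (f := fun t : tensor (dual K) K =>
    \tsum_(f ⊗ w <- t) ((f v : k) *: w))); last by lin.
  apply: dual_eq0 => p; rewrite dual_tsum.
  transitivity ((lact x t ⋅ p) v); last first.
    by rewrite xt0 (islin0 (alg_mul_linl p)) lfunE.
  rewrite lact_mul eval_tsum; apply: eq_tsum => x1 x2.
  rewrite ti (islinZ (islin_lactr x2)) scale_lfunE -[counit _]/(ltrans x1 p _).
  by rewrite ltransE alg_mul1r; tens; rewrite linearZ /GRing.scale /= mulrC.
apply/eqP; apply: contraNT t0 => x0; apply/eqP/lfunP=> y; rewrite lfunE.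
suff : (t y : k) *: x = 0 by move/eqP; rewrite scaler_eq0 (negPf x0) orbF => /eqP.
transitivity (\tsum_(q ⊗ x1 <- \tsum_(x1 ⊗ x2 <- comul x) (lact x2 t ⊗ x1))
  \tsum_(a ⊗ b <- comul x1) ((lact (S b) q y : k) *: a)); last first.
  by rewrite T0 (islin0 (tsum_islin _)).
rewrite tsum_tsum.
transitivity (\tsum_(x1 ⊗ x2 <- comul x) \tsum_(a ⊗ b <- comul x1)
  ((lact (S b ⋅ x2) t y : k) *: a)); last first.
  apply: eq_tsum => x1 x2; tens; apply: eq_tsum => a b.
  by rewrite lactA.
rewrite (comulA_tsum (F := fun a b x2 => (lact (S b ⋅ x2) t y : k) *: a));
  [|by lin..].
rewrite -[in LHS](counitr x) scaler_tsum; apply: eq_tsum => x1 x2.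
rewrite (antipodel_tsum (F := fun w => (lact w t y : k) *: x1)); last by lin.
by rewrite lact1 !scalerA mulrC.
Qed.

Lemma dual_integral t x y :
    (forall p, t ⋅ p = (counit p : k) *: t) ->
  \tsum_(x1 ⊗ x2 <- comul x) ((t x1 : k) *: x2) = (t x : k) *: alg_one.
Proof.
move=> ti; apply/eqP; rewrite -subr_eq0; apply/eqP/dual_eq0 => p.
rewrite linearB /= dual_tsum linearZ /=.
have /lfunP/(_ x) := ti p; rewrite dual_mul_algE scale_lfunE.
rewrite -[counit p]/(p alg_one) /GRing.scale /= => eq; apply/eqP.
rewrite subr_eq0 [t x * _]mulrC -eq; apply/eqP/eq_tsum => x1 x2.
by rewrite linearZ.
Qed.

(** By dimension, x ↦ lact x t is onto, so t is nondegenerate. Hence some L satisfies t (y L) = ε(y)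
    for all y, and nondegeneracy makes L a left integral. *)
Lemma integral_pair :
  exists (t : dual K) (L : K),
  [/\ forall x, \tsum_(x1 ⊗ x2 <- comul x) ((t x1 : k) *: x2) =
        (t x : k) *: alg_one,
      forall x, x ⋅ L = (counit x : k) *: L,
      t L = 1 & forall x x', (forall y, t (y ⋅ x) = t (y ⋅ x')) -> x = x'].
Proof.
have [t t0 ti] := integral_exists.
have nd x : (forall y, t (y ⋅ x) = 0) -> x = 0.
  move=> tx; apply: dual_eq0 => p.
  have [z <-] := inj_islin_surj (islin_lactl t)
    (fun u => @lact_integral_inj t u t0 ti) (dim_dual K) p.
  by rewrite lactE.
pose rt x : dual K := linfun (fun y => t (y ⋅ x) : k^o).
have rtE x y : rt x y = t (y ⋅ x) by rewrite linfunE //; lin.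
have rtl : islin rt.
  move=> a x y; apply/lfunP=> z; rewrite add_lfunE scale_lfunE !rtE.
  by rewrite alg_mul_linr linearP.
have rt0 x : rt x = 0 -> x = 0.
  by move=> x0; apply: nd => y; rewrite -rtE x0 lfunE.
have [L LE] := inj_islin_surj rtl rt0 (dim_dual K) alg_one.
have tL y : t (y ⋅ L) = counit y by rewrite -rtE LE dual_oneE.
have nd' x x' : (forall y, t (y ⋅ x) = t (y ⋅ x')) -> x = x'.
  move=> eq; apply/eqP; rewrite -subr_eq0; apply/eqP/nd => y.
  rewrite -[- x']scaleN1r addrC alg_mul_linr linearP /= eq.
  by rewrite /GRing.scale /= mulN1r addNr.
exists t, L; split=> //.
- by move=> x; apply: dual_integral.
- move=> x; apply: nd' => y; rewrite scale_mulr linearZ /= alg_mulA !tL counitM.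
  by rewrite /GRing.scale /= mulrC.
- by rewrite -[L in LHS]alg_mul1l tL counit1.
Qed.

(* The witness is L1 ⊗ S L2 for a left integral L with t L = 1. *)
Lemma hopf_frobenius :
  exists (t : dual K) (c : tensor K K),
  [/\ forall x, \tsum_(x1 ⊗ x2 <- comul x) ((t x1 : k) *: x2) =
        (t x : k) *: alg_one,
      casimir c,
      \tsum_(a ⊗ b <- c) ((t a : k) *: b) = alg_one,
      \tsum_(a ⊗ b <- c) ((t b : k) *: a) = alg_one &
      \tsum_(a ⊗ b <- c) \tsum_(a1 ⊗ a2 <- comul a)
        \tsum_(b1 ⊗ b2 <- comul b) ((a1 ⊗ b1) ⊗ (a2 ⋅ b2)) =
      c ⊗ alg_one].
Proof.
have [t [L [tint Lint tL nd]]] := integral_pair.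
pose c := \tsum_(a ⊗ b <- comul L) (a ⊗ S b).
have cE (W : lmodType k) (F : K -> K -> W) :
    (forall b, islin (F^~ b)) -> (forall a, islin (F a)) ->
    tsum c F = \tsum_(a ⊗ b <- comul L) F a (S b).
  by move=> l1 l2; rewrite tsum_tsum; apply: eq_tsum => a b; rewrite tsum_tens.
have central : casimir c.
  move=> x; rewrite !cE; [|by lin..].
  (* Both sides equal \sum (x1 L)_1 ⊗ S ((x1 L)_2) x2: on the right since x1 L = ε(x1) L, on the
     left by cancelling S x2 x3. *)
  transitivity (\tsum_(x1 ⊗ x2 <- comul x) \tsum_(a ⊗ b <- comul (x1 ⋅ L))
     (a ⊗ (S b ⋅ x2))); last first.
    rewrite -[in RHS](counitl x).
    under [RHS]eq_tsum => a b do rewrite mulr_tsum tensr_tsum.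
    rewrite [RHS]tsum_swap; apply: eq_tsum => x1 x2.
    rewrite Lint linearZ (islinZ (tsum_islin _)) scaler_tsum.
    by apply: eq_tsum => a b; rewrite scale_mulr scale_tensr.
  transitivity (\tsum_(x1 ⊗ x2 <- comul x) \tsum_(x3 ⊗ x4 <- comul x1)
    \tsum_(a ⊗ b <- comul L) ((x3 ⋅ a) ⊗ (S b ⋅ (S x4 ⋅ x2)))); last first.
    apply: eq_tsum => x1 x2; rewrite comulM_tsum; [|by lin..].
    apply: eq_tsum => x3 x4; apply: eq_tsum => a b.
    by rewrite antipodeM alg_mulA.
  rewrite (comulA_tsum (F := fun x3 x4 x2 => \tsum_(a ⊗ b <- comul L)
    ((x3 ⋅ a) ⊗ (S b ⋅ (S x4 ⋅ x2))))); [|by lin..].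
  rewrite -[LHS](counitr_tsum (F := fun y => \tsum_(a ⊗ b <- comul L)
    ((y ⋅ a) ⊗ S b))); last by lin.
  apply: eq_tsum => x1 x2.
  rewrite (antipodel_tsum (F := fun w => \tsum_(a ⊗ b <- comul L)
    ((x1 ⋅ a) ⊗ (S b ⋅ w)))); last by lin.
  by congr (_ *: _); apply: eq_tsum => a b; rewrite alg_mul1r.
have cl : \tsum_(a ⊗ b <- c) ((t a : k) *: b) = alg_one.
  rewrite cE; [|by lin..].
  transitivity (S (\tsum_(a ⊗ b <- comul L) ((t a : k) *: b))).
    by rewrite map_tsum; apply: eq_tsum => a b; rewrite linearZ.
  by rewrite tint tL scale1r antipode1.
exists t, c; split=> //.
(* The other duality follows from the first by nondegeneracy, since \sum t(y a) t(b) = \sum t(a) t(b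
   y) = t(y). *)
- apply: nd => y; rewrite alg_mul1r.
  transitivity (t (\tsum_(a ⊗ b <- \tsum_(a ⊗ b <- c) ((y ⋅ a) ⊗ b))
     ((t a : k) *: b))).
    rewrite mulr_tsum tsum_tsum !dual_tsum; apply: eq_tsum => a b.
    by tens; rewrite scale_mulr !linearZ /= /GRing.scale /= mulrC.
  rewrite central tsum_tsum -[y in RHS]alg_mul1l -cl mull_tsum.
  by congr (t _); apply: eq_tsum => a b; tens; rewrite scale_mull.
- rewrite cE; [|by lin..].
  transitivity (\tsum_(a ⊗ b <- comul L) \tsum_(b1 ⊗ b2 <- comul b)
    \tsum_(u ⊗ v <- comul (S b2)) ((a ⊗ u) ⊗ (b1 ⋅ v))).
    rewrite -(comulA_tsum (F := fun a1 a2 b =>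
      \tsum_(b1 ⊗ b2 <- comul (S b)) ((a1 ⊗ b1) ⊗ (a2 ⋅ b2)))) //; lin.
  rewrite tensl_tsum; apply: eq_tsum => a b.
  transitivity (\tsum_(u ⊗ v <- S b ⊗ (alg_one : K)) ((a ⊗ u) ⊗ v)); last first.
    by tens.
  rewrite -antipode_comulr tsum_tsum; apply: eq_tsum => b1 b2.
  by rewrite tsum_tsum; apply: eq_tsum => u v; tens.
Qed.

End Integrals.

(** * Frobenius structures as dual pairs of a form and a Casimir element *)

Section Casimir.
Variables (k : fieldType) (L : bialgType k) (R : comodAlgType L).
Implicit Types (D : tensor R R) (r s : R).

Lemma frobenius_casimir D (l : {linear R -> k^o}) :
    casimir D ->
    \tsum_(x ⊗ y <- D) ((l x : k) *: y) = alg_one ->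
    \tsum_(x ⊗ y <- D) ((l y : k) *: x) = alg_one ->
    colinear (H := L) l ->
    tens_coact D = D ⊗ alg_one ->
  frobenius_in_comod L R.
Proof.
move=> cD lD rD lcol Dco.
pose d r : tensor R R := \tsum_(x ⊗ y <- D) ((r ⋅ x) ⊗ y).
have dl : islin d by rewrite /d; lin.
pose dm := GRing.isLinear.Build k _ _ *:%R d dl.
pose dlin : {linear R -> tensor R R} := HB.pack d dm.
exists dlin, l; split; [split=> r | split=> [r||]].
- rewrite /= /d !tsum_tsum.
  (* With two copies of D, both iterated comultiplications become \sum r x ⊗ x' ⊗ y' y once factors
     are moved across D. *)
  transitivity (\tsum_(x ⊗ y <- D) \tsum_(x' ⊗ y' <- D)
    ((r ⋅ x) ⊗ (x' ⊗ (y' ⋅ y)))); last first.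
    apply: eq_tsum => x y; tens; rewrite -tensr_tsum.
    by congr (_ ⊗ _); rewrite -cD.
  transitivity (\tsum_(x ⊗ y <- D) \tsum_(x' ⊗ y' <- D)
    ((r ⋅ x') ⊗ ((y' ⋅ x) ⊗ y))).
    apply: eq_tsum => x y; tens.
    rewrite tsum_tsum.
    rewrite -(casimir_tsum (F := fun x' y' => (r ⋅ x') ⊗ (y' ⊗ y)) x cD);
      [|by lin..].
    by apply: eq_tsum => x' y'; tens; rewrite alg_mulA.
  rewrite tsum_swap; apply: eq_tsum => x y.
  rewrite -(casimir_tsum (F := fun x' y' => (r ⋅ x) ⊗ (x' ⊗ y')) y cD) //; lin.
- rewrite /= tsum_tsum.
  transitivity (\tsum_(x ⊗ y <- D) ((l (r ⋅ x) : k) *: y)).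
    by apply: eq_tsum => x y; tens.
  rewrite (casimir_tsum (F := fun x y => (l x : k) *: y) r cD); [|by lin..].
  rewrite -[RHS]alg_mul1l -lD mull_tsum; apply: eq_tsum => x y.
  by rewrite scale_mull.
- rewrite /= tsum_tsum -[RHS]alg_mul1r -rD mulr_tsum; apply: eq_tsum => x y.
  by tens; rewrite scale_mulr.
- rewrite /= /d.
  (* Inserting D ⊗ 1, which is the coaction of D, reduces colinearity of r ↦ r D to multiplicativity
     of the coaction of R. *)
  transitivity (\tsum_(r0 ⊗ r1 <- coact r) \tsum_(t ⊗ u <- D ⊗ (alg_one : L))
    ((\tsum_(x ⊗ y <- t) ((r0 ⋅ x) ⊗ y)) ⊗ (r1 ⋅ u))); last first.
    by apply: eq_tsum => r0 r1; tens; rewrite alg_mul1r.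
  rewrite -Dco map_tsum.
  rewrite (eq_tsum (G := fun x y => \tsum_(r0 ⊗ r1 <- coact r)
   \tsum_(x0 ⊗ x1 <- coact x) \tsum_(y0 ⊗ y1 <- coact y)
    (((r0 ⋅ x0) ⊗ y0) ⊗ (r1 ⋅ x1 ⋅ y1)))) => [|x y]; last first.
    by rewrite [LHS]tens_coactE coactM_tsum; [|by lin..].
  rewrite (tsum_comp _ _ (g := fun t => \tsum_(r0 ⊗ r1 <- coact r)
    \tsum_(t ⊗ u <- t) ((\tsum_(x ⊗ y <- t) ((r0 ⋅ x) ⊗ y)) ⊗ (r1 ⋅ u))));
    last by lin.
  apply: eq_tsum => x y; apply: eq_tsum => r0 r1.
  rewrite tsum_tsum; apply: eq_tsum => x0 x1.
  rewrite tsum_tsum; apply: eq_tsum => y0 y1.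
  by tens; tens; rewrite alg_mulA.
- exact: lcol.
- split=> a b /=; rewrite /d tsum_tsum.
    by apply: eq_tsum => x y; tens; rewrite alg_mulA.
  transitivity (\tsum_(x ⊗ y <- D) ((a ⋅ x) ⊗ (y ⋅ b))); last first.
    by apply: eq_tsum => x y; tens.
  rewrite -(casimir_tsum (F := fun x y => (a ⋅ x) ⊗ y) b cD); [|by lin..].
  by apply: eq_tsum => x y; rewrite alg_mulA.
Qed.

Lemma frobenius_casimir_exists : frobenius_in_comod L R ->
  exists D (l : {linear R -> k^o}),
  [/\ casimir D,
      \tsum_(x ⊗ y <- D) ((l x : k) *: y) = alg_one,
      \tsum_(x ⊗ y <- D) ((l y : k) *: x) = alg_one,
      forall r, \tsum_(r0 ⊗ r1 <- coact r) ((l r0 : k) *: r1) =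
        (l r : k) *: alg_one &
      tens_coact D = D ⊗ alg_one].
Proof.
case=> [d [l [[_ dl dr] [dco lco [bl br]]]]].
exists (d alg_one), l; split=> [r|||r|].
- by rewrite -bl -br alg_mul1l alg_mul1r.
- exact: dl.
- exact: dr.
- have := congr1 (fun t : tensor k^o L => \tsum_(c ⊗ u <- t) ((c : k) *: u)) (lco r).
  rewrite /= tsum_tsum => eq; etransitivity; [|etransitivity; [exact: esym eq|]].
    by apply: eq_tsum => r0 r1; tens.
  by rewrite -[coact _]/(_ ⊗ _); tens.
- rewrite -[LHS]/(coact (d alg_one)) dco coact1.
  by tens.
Qed.

End Casimir.

(** * The smash product *)

Section SmashFrobenius.
Variables (k : fieldType) (H : hopfAlgType k) (A : comodAlgType H).
Implicit Types (a b : A) (f g : dual H).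
Local Notation one := (alg_one : A).
Local Notation eps := (alg_one : dual H).

Lemma smash_mul_tens a b f g :
  (a ⊗ f : smash A) ⋅ (b ⊗ g : smash A) =
  \tsum_(f1 ⊗ f2 <- comul f) ((a ⋅ (f1 ⇀ b)) ⊗ (f2 ⋅ g)).
Proof. exact: smash_mulE. Qed.

Lemma smash_mul_one a b g : (a ⊗ eps : smash A) ⋅ (b ⊗ g : smash A) = (a ⋅ b) ⊗ g.
Proof.
rewrite smash_mul_tens comul1_tsum; [|by lin..].
by rewrite act1 alg_mul1l.
Qed.

Lemma smash_one_mul f g : (one ⊗ f : smash A) ⋅ (one ⊗ g : smash A) = one ⊗ (f ⋅ g).
Proof.
rewrite smash_mul_tens -[f in RHS]counitl mull_tsum tensr_tsum.
apply: eq_tsum => f1 f2.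
by rewrite act_one scale_mulr alg_mul1l scale_tensl scale_mull scale_tensr.
Qed.

(** Apply g to the H-leg of the coinvariance identity; g of a product in H is given by the
    comultiplication of g. *)
Lemma act_coinvariant (e : tensor A A) g : tens_coact e = e ⊗ alg_one ->
  \tsum_(a ⊗ b <- e) \tsum_(g1 ⊗ g2 <- comul g) ((g1 ⇀ a) ⊗ (g2 ⇀ b)) =
  (counit g : k) *: e.
Proof.
move=> eco; transitivity (\tsum_(t ⊗ u <- e ⊗ (alg_one : H)) ((g u : k) *: t)).
  rewrite -eco tsum_tsum; apply: eq_tsum => a b.
  rewrite tsum_tsum.
  under eq_tsum => g1 g2 do rewrite [g1 ⇀ a]/dual_act tensl_tsum.
  rewrite tsum_swap; apply: eq_tsum => a0 a1; rewrite tsum_tsum.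
  under eq_tsum => g1 g2 do rewrite [g2 ⇀ b]/dual_act tensr_tsum.
  rewrite tsum_swap; apply: eq_tsum => b0 b1; tens.
  rewrite -dual_comulE scalel_tsum; apply: eq_tsum => g1 g2.
  by rewrite scale_tensl scale_tensr scalerA.
by tens.
Qed.

End SmashFrobenius.

Theorem theorem3p1 (k : fieldType) (H : hopfAlgType k) (A : comodAlgType H)
    (hA : frobenius_in_comod H A) :
  frobenius_in_comod (dual H) (smash A).
Proof.
have [e [l [ce le re lcol eco]]] := frobenius_casimir_exists hA.
have [t [c [tint cc lc rc cco]]] := hopf_frobenius (dual H).
pose R : comodAlgType (dual H) := smash A.
have act_e := act_coinvariant _ eco.
have coactE a f : coact (a ⊗ f : R) =
    \tsum_(f1 ⊗ f2 <- comul f) ((a ⊗ f1 : R) ⊗ f2) by exact: smash_coactE.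
have l_act f a : l (f ⇀ a) = counit f * l a.
  rewrite map_tsum; transitivity (f (\tsum_(a0 ⊗ a1 <- coact a) ((l a0 : k) *: a1))).
    rewrite dual_tsum; apply: eq_tsum => a0 a1.
    by rewrite !linearZ /= /GRing.scale /= mulrC.
  by rewrite lcol linearZ /= /GRing.scale /= mulrC.
pose D : tensor R R := \tsum_(a ⊗ b <- e) \tsum_(x ⊗ y <- c)
  ((a ⊗ x : R) ⊗ ((alg_one ⊗ y : R) ⋅ (b ⊗ alg_one : R))).
have DE (W : lmodType k) (F : R -> R -> W) :
    (forall b, islin (F^~ b)) -> (forall a, islin (F a)) ->
    tsum D F = \tsum_(a ⊗ b <- e) \tsum_(x ⊗ y <- c)
      F (a ⊗ x) ((alg_one ⊗ y : R) ⋅ (b ⊗ alg_one : R)).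
  move=> l1 l2; rewrite tsum_tsum; apply: eq_tsum => a b.
  by rewrite tsum_tsum; apply: eq_tsum => x y; rewrite tsum_tens.
pose lam (s : R) : k^o := \tsum_(a ⊗ f <- s) (l a * t f : k^o).
have lamE a f : lam (a ⊗ f) = l a * t f by rewrite /lam; tens.
have laml : islin lam by rewrite /lam; lin.
pose lamm := GRing.isLinear.Build k R k^o *:%R lam laml.
pose lamlin : {linear R -> k^o} := HB.pack lam lamm.
(* The product is \sum (y1 ⇀ b) # y2, and [l_act] turns y1 into its counit. *)
have lam_y y b : lam ((alg_one ⊗ y : R) ⋅ (b ⊗ alg_one : R)) = t y * l b.
  rewrite smash_mul_tens (tsum_comp _ _ laml).
  transitivity (\tsum_(y1 ⊗ y2 <- comul y) (l b * t ((counit y1 : k) *: y2) : k^o)).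
    apply: eq_tsum => y1 y2; rewrite lamE alg_mul1l alg_mul1r l_act.
    by rewrite linearZ /= /GRing.scale /= mulrCA mulrA.
  by rewrite -kmulr_tsum -dual_tsum counitl mulrC.
apply: (@frobenius_casimir k (dual H) R D lamlin) => [s|||s|].
- rewrite !DE; [|by lin..].
  pose G1 (s : R) := \tsum_(a ⊗ b <- e) \tsum_(x ⊗ y <- c)
    ((s ⋅ (a ⊗ x : R)) ⊗ ((alg_one ⊗ y : R) ⋅ (b ⊗ alg_one : R))).
  pose G2 (s : R) := \tsum_(a ⊗ b <- e) \tsum_(x ⊗ y <- c)
    ((a ⊗ x : R) ⊗ (((alg_one ⊗ y : R) ⋅ (b ⊗ alg_one : R)) ⋅ s)).
  have l1 : islin G1 by rewrite /G1; lin.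
  have l2 : islin G2 by rewrite /G2; lin.
  apply: (tens_ext l1 l2 (k := k)) => a f; rewrite /G1 /G2.
  pose G p q g : tensor R R := \tsum_(x ⊗ y <- c)
    (((a ⋅ p) ⊗ x : R) ⊗ ((alg_one ⊗ y : R) ⋅ (q ⊗ g : R))).
  (* Here D (a # f) reaches this sum by moving a across e. For (a # f) D, f2 is moved across c and
     then past q, so f1 and f2 act on the two legs of e, where [act_e] absorbs them. *)
  transitivity (\tsum_(p ⊗ q <- e) G p q f); last first.
    transitivity (\tsum_(p ⊗ q <- e) \tsum_(x ⊗ y <- c)
      ((p ⊗ x : R) ⊗ ((alg_one ⊗ y : R) ⋅ ((q ⋅ a) ⊗ f : R)))).
      rewrite -(casimir_tsum (F := fun p q => \tsum_(x ⊗ y <- c)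
        ((p ⊗ x : R) ⊗ ((alg_one ⊗ y : R) ⋅ (q ⊗ f : R)))) a ce) //; lin.
    by apply: eq_tsum => p q; apply: eq_tsum => x y;
      rewrite -alg_mulA smash_mul_one.
  transitivity (\tsum_(f1 ⊗ f2 <- comul f) \tsum_(f3 ⊗ f4 <- comul f1)
    \tsum_(p ⊗ q <- e) G (f3 ⇀ p) (f4 ⇀ q) f2); last first.
    rewrite -[RHS](counitl_tsum (F := fun g => \tsum_(p ⊗ q <- e) G p q g));
      last by rewrite /G; lin.
    apply: eq_tsum => f1 f2; rewrite -(islinZ (tsum_islin _)) -act_e.
    rewrite tsum_tsum tsum_swap; apply: eq_tsum => p q.
    by rewrite tsum_tsum; apply: eq_tsum => f3 f4; rewrite /G; tens.
  rewrite (comulA_tsum (F := fun f3 f4 f2 =>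
     \tsum_(p ⊗ q <- e) G (f3 ⇀ p) (f4 ⇀ q) f2)); [|by rewrite /G; lin..].
  transitivity (\tsum_(p ⊗ q <- e) \tsum_(f1 ⊗ f2 <- comul f)
    \tsum_(f3 ⊗ f4 <- comul f2) G (f1 ⇀ p) (f3 ⇀ q) f4); last first.
    by rewrite tsum_swap; apply: eq_tsum => f1 f2; rewrite tsum_swap.
  apply: eq_tsum => p q.
  transitivity (\tsum_(f1 ⊗ f2 <- comul f) \tsum_(x ⊗ y <- c)
    (((a ⋅ (f1 ⇀ p)) ⊗ (f2 ⋅ x) : R) ⊗
       ((alg_one ⊗ y : R) ⋅ (q ⊗ alg_one : R)))).
    rewrite tsum_swap; apply: eq_tsum => x y.
    by rewrite smash_mul_tens tensl_tsum.
  apply: eq_tsum => f1 f2.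
  rewrite (casimir_tsum (F := fun x y => ((a ⋅ (f1 ⇀ p)) ⊗ x : R) ⊗
       ((alg_one ⊗ y : R) ⋅ (q ⊗ alg_one : R))) f2 cc); [|by lin..].
  rewrite /G tsum_swap; apply: eq_tsum => x y.
  have <- : (alg_one ⊗ y : R) ⋅ (\tsum_(f3 ⊗ f4 <- comul f2) ((f3 ⇀ q) ⊗ f4) : R)
      = (alg_one ⊗ (y ⋅ f2) : R) ⋅ (q ⊗ alg_one : R).
    rewrite -smash_one_mul -alg_mulA; congr (_ ⋅ _); rewrite smash_mul_tens.
    by apply: eq_tsum => f3 f4; rewrite alg_mul1l alg_mul1r.
  by rewrite (mulr_tsum (A := R)) [LHS]tensr_tsum.
- rewrite DE; [|by lin..].
  transitivity (\tsum_(p ⊗ q <- e) ((l p : k) *: (q ⊗ alg_one : R))); last first.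
    transitivity (\tsum_(p ⊗ q <- e) (((l p : k) *: q) ⊗ alg_one : R)).
      by apply: eq_tsum => p q; rewrite scale_tensl.
    by rewrite -tensl_tsum le.
  apply: eq_tsum => p q.
  transitivity ((l p : k) *: ((alg_one ⊗ (\tsum_(x ⊗ y <- c) ((t x : k) *: y)) : R)
    ⋅ (q ⊗ alg_one : R))); last by rewrite lc smash_mul_one alg_mul1l.
  rewrite tensr_tsum (mull_tsum (A := R)) scaler_tsum; apply: eq_tsum => x y.
  by rewrite /= lamE scale_tensr scale_mull scalerA.
- rewrite DE; [|by lin..].
  transitivity ((\tsum_(p ⊗ q <- e) ((l q : k) *: p)) ⊗
    (\tsum_(x ⊗ y <- c) ((t y : k) *: x)) : R); last by rewrite re rc.
  rewrite tensl_tsum; apply: eq_tsum => p q.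
  rewrite tensr_tsum; apply: eq_tsum => x y.
  by rewrite /= lam_y scale_tensl scale_tensr scalerA mulrC.
- pose G1 (s : R) : tensor k^o (dual H) := lam s ⊗ alg_one.
  pose G2 (s : R) : tensor k^o (dual H) :=
    \tsum_(s0 ⊗ s1 <- coact s) (lam s0 ⊗ s1).
  have l1 : islin G1 by rewrite /G1; lin.
  have l2 : islin G2 by rewrite /G2; lin.
  apply: (tens_ext l1 l2 (k := k)) => a f; rewrite /G1 /G2.
  rewrite [coact _]smash_coactE tsum_tsum lamE.
  transitivity ((l a : k^o) ⊗ \tsum_(f1 ⊗ f2 <- comul f) ((t f1 : k) *: f2)).
    by rewrite tint scale_tensr -scale_tensl /GRing.scale /= mulrC.
  rewrite tensr_tsum; apply: eq_tsum => f1 f2; tens.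
  by rewrite lamE scale_tensr -scale_tensl /GRing.scale /= mulrC.
- rewrite /D map_tsum tensl_tsum; apply: eq_tsum => p q.
  rewrite map_tsum.
  (* The legs p # 1 and q # 1 are coinvariant, so only c contributes to the coaction, and c is
     coinvariant by [cco]. *)
  transitivity (\tsum_(v ⊗ g <- c ⊗ (alg_one : dual H))
    ((\tsum_(x ⊗ y <- v) ((p ⊗ x : R) ⊗
       ((alg_one ⊗ y : R) ⋅ (q ⊗ alg_one : R)))) ⊗ g)); last by tens.
  rewrite -cco tsum_tsum; apply: eq_tsum => x y.
  rewrite [LHS]tens_coactE coactE !tsum_tsum.
  apply: eq_tsum => x1 x2; tens; rewrite coactM_tsum; [|by lin..].
  rewrite coactE !tsum_tsum; apply: eq_tsum => y1 y2; tens; tens; tens.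
  rewrite coactE comul1; do 2 tens.
  by rewrite alg_mul1r.
Qed.
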